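(* Let $n\ge 1$ be an integer, $p,q\in[1,\infty)$ and $\lambda,\sigma,\alpha,\beta\in(0,\infty)$. Assume that $$\left(p>1\text{ and }0<\alpha<\tfrac{n+2}{2p}\right)\ \text{ or }\ \left(p=1\text{ and }0<\alpha\le\tfrac{n+2}{2p}\right),$$ $$\left(q>1\text{ and }0<\beta<\tfrac{n+2}{2q}\right)\ \text{ or }\ \left(q=1\text{ and }0<\beta\le\tfrac{n+2}{2q}\right),$$ that $(n+2-2p\alpha)q^2\sigma\le(n+2-2q\beta)p^2\lambda$, that $2p\alpha<n+2$, and that $$\frac1\lambda\le\sigma<\mu(\lambda),\qquad \mu(\lambda):=\frac{2p\beta}{n+2-2p\alpha}+\frac{n+2}{(n+2-2p\alpha)\lambda}.$$ Suppose $u\in Y^p_\alpha$ and $v\in Y^q_\beta$ are (necessarily nonnegative) solutions of $$0\le(\partial_t-\Delta)^\alpha u\le v^\lambda,\qquad 0\le(\partial_t-\Delta)^\beta v\le u^\sigma\qquad\text{in }\mathbb{R}^n\times\mathbb{R},$$ $$u=v=0\quad\text{in }\mathbb{R}^n\times(-\infty,0).$$ Then $u=v=0$ a.e. in $\mathbb{R}^n\times\mathbb{R}$.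
   Context: For $p\ge1$, $X^p:=\bigcap_{T\in\mathbb{R}}L^p(\mathbb{R}^n\times(-\infty,T))$, i.e. the set of measurable $f:\mathbb{R}^n\times\mathbb{R}\to\mathbb{R}$ with $\|f\|_{L^p(\mathbb{R}^n\times(-\infty,T))}<\infty$ for all $T\in\mathbb{R}$ (functions equal a.e. are identified). For $\alpha>0$ the fractional heat kernel is $$\Phi_\alpha(x,t):=\frac{t^{\alpha-1}}{\Gamma(\alpha)}\frac{1}{(4\pi t)^{n/2}}e^{-|x|^2/(4t)}\chi_{(0,\infty)}(t),$$ and $$J_\alpha f(x,t):=\iint_{\mathbb{R}^n\times(-\infty,t)}\Phi_\alpha(x-\xi,t-\tau)f(\xi,\tau)\,d\xi\,d\tau .$$ Set $Y^p_\alpha:=J_\alpha(X^p)$. When ($p>1$ and $0<\alpha<\frac{n+2}{2p}$) or ($p=1$ and $0<\alpha\le\frac{n+2}{2p}$), it is known that $J_\alpha f\in L^p_{\rm loc}(\mathbb{R}^n\times\mathbb{R})$ for $f\in X^p$ and that $J_\alpha:X^p\to Y^p_\alpha$ is one-to-one and onto; the fully fractional heat operator $(\partial_t-\Delta)^\alpha:Y^p_\alpha\to X^p$ is defined as the inverse of $J_\alpha:X^p\to Y^p_\alpha$. Likewise $(\partial_t-\Delta)^\beta:Y^q_\beta\to X^q$ is the inverse of $J_\beta:X^q\to Y^q_\beta$. *)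

(* Defs.v *)
From HB Require Import structures.
From mathcomp Require Import all_boot all_order all_algebra.
From mathcomp Require Import all_classical all_reals all_analysis.

Set Implicit Arguments.
Unset Strict Implicit.
Unset Printing Implicit Defensive.
Import Order.TTheory GRing.Theory Num.Theory.
Import numFieldNormedType.Exports.

Local Open Scope classical_set_scope.
Local Open Scope ring_scope.

Notation euclid R n := (n.-tuple (measurableTypeR R)).
Notation spacetime R n := (euclid R n * measurableTypeR R)%type.

(* The library's sigma-finite instance on products of measures is keyed on
   subprobabilities, which does not cover Lebesgue measure. *)
Lemma sigma_finite_product d1 d2 (T1 : measurableType d1)
    (T2 : measurableType d2) (R : realType)
    (m1 : {sigma_finite_measure set T1 -> \bar R})
    (m2 : {sigma_finite_measure set T2 -> \bar R}) :
  sigma_finite setT (m1 \x m2)%E.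
Proof.
have /sigma_finiteP[F [TF ndF Foo]] := sigma_finiteT m1.
have /sigma_finiteP[G [TG ndG Goo]] := sigma_finiteT m2.
exists (fun n => F n `*` G n).
  rewrite -setXTT TF TG predeqE => -[x y]; split.
    move=> [/= [n _ Fnx] [k _ Gky]]; exists (maxn n k) => //; split.
    - by move: x Fnx; exact/subsetPset/ndF/leq_maxl.
    - by move: y Gky; exact/subsetPset/ndG/leq_maxr.
  by move=> [n _ []/= ? ?]; split; exists n.
move=> k; have [? ?] := Foo k; have [? ?] := Goo k.
split; first exact: measurableX.
by rewrite product_measure1E// lte_mul_pinfty// ge0_fin_numE.
Qed.

(* Lebesgue measure on R^n, by recursion on n: the measure on R^(n+1) is the
   image of the product of Lebesgue measure on R and the measure on R^n under
   (a, x) |-> a :: x. *)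
Section lebesgue_euclid.
Context {R : realType}.
Local Open Scope ereal_scope.

Definition consE n (z : measurableTypeR R * euclid R n) : euclid R n.+1 :=
  [the n.+1.-tuple (measurableTypeR R) of z.1 :: z.2].

Lemma measurable_consE n : measurable_fun setT (@consE n).
Proof. by apply: measurable_cons. Qed.

Section step.
Variables (n : nat) (m : {sigma_finite_measure set (euclid R n) -> \bar R}).

Definition lebesgue_step : set (euclid R n.+1) -> \bar R :=
  pushforward (@lebesgue_measure R \x m) (@consE n).

Let step0 : lebesgue_step set0 = 0.
Proof. by rewrite /lebesgue_step /pushforward preimage_set0 measure0. Qed.

Let step_ge0 A : 0 <= lebesgue_step A.
Proof. by rewrite /lebesgue_step /pushforward measure_ge0. Qed.

Let step_sigma_additive : semi_sigma_additive lebesgue_step.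
Proof.
move=> F mF tF mUF; rewrite /lebesgue_step /pushforward preimage_bigcup.
have mc (A : set (euclid R n.+1)) : measurable A ->
    measurable (@consE n @^-1` A).
  by move=> mA; rewrite -[X in measurable X]setTI; exact: measurable_consE.
apply: measure_semi_sigma_additive.
- by move=> i; exact: mc.
- apply/trivIsetP => /= i j _ _ ij; rewrite -preimage_setI.
  by move/trivIsetP : tF => /(_ _ _ _ _ ij) ->//; rewrite preimage_set0.
- by rewrite -preimage_bigcup; exact: mc.
Qed.

HB.instance Definition _ := isMeasure.Build _ _ _
  lebesgue_step step0 step_ge0 step_sigma_additive.

Let step_sigma_finite : sigma_finite setT lebesgue_step.
Proof.
have [F TF Foo] := sigma_finite_product (@lebesgue_measure R) m.
pose g (x : euclid R n.+1) : measurableTypeR R * euclid R n :=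
  (tnth x ord0, [tuple of behead x]).
have gK : cancel (@consE n) g by move=> [a x]; congr pair; exact/val_inj.
have mg : measurable_fun setT g.
  by apply/measurable_fun_pair;
    [exact: measurable_tnth|exact: measurable_behead].
exists (fun i => g @^-1` F i).
  by rewrite -preimage_bigcup -TF preimage_setT.
move=> i; have [mF Fi] := Foo i; split.
  by rewrite -[X in measurable X]setTI; exact: mg.
rewrite /lebesgue_step /pushforward -comp_preimage.
by rewrite (_ : g \o @consE n = id)//; apply/funext => z; exact: gK.
Qed.

HB.instance Definition _ := @Measure_isSigmaFinite.Build _ _ _ lebesgue_step
  step_sigma_finite.

End step.

Fixpoint lebesgue_euclid n :
    {sigma_finite_measure set (euclid R n) -> \bar R} :=
  if n isn't k.+1 then
    (\d_([tuple] : euclid R 0) : {sigma_finite_measure set _ -> \bar R})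
  else lebesgue_step (lebesgue_euclid k).

Definition lebesgue_spacetime n : set (spacetime R n) -> \bar R :=
  lebesgue_euclid n \x @lebesgue_measure R.

HB.instance Definition _ n := Measure.on (@lebesgue_spacetime n).
HB.instance Definition _ n := @Measure_isSigmaFinite.Build _ _ _
  (@lebesgue_spacetime n)
  (sigma_finite_product (lebesgue_euclid n) (@lebesgue_measure R)).

Lemma lebesgue_euclid_box n (A : 'I_n -> set (measurableTypeR R)) :
  (forall i, measurable (A i)) ->
  lebesgue_euclid n [set x | forall i, A i (tnth x i)] =
  \prod_(i < n) lebesgue_measure (A i).
Proof.
elim: n A => [|n IHn] A mA.
  rewrite big_ord0 /= diracE.
  by rewrite (_ : _ \in _ = true)//; apply/mem_set => -[].
rewrite big_ord_recl /= -IHn; last by move=> i; exact: mA.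
rewrite -product_measure1E//; last first.
  rewrite (_ : [set _ | _] =
      \bigcap_(i in [set: 'I_n]) ((@tnth n _)^~ i @^-1` A (lift ord0 i))).
    apply: fin_bigcap_measurable => //= i _.
    by rewrite -[X in measurable X]setTI; exact: measurable_tnth.
  by apply/seteqP; split => [x Ax i _|x Ax i]; exact: Ax.
rewrite /lebesgue_step /pushforward; congr product_measure1.
apply/seteqP; split => [[a x] /= Ax|[a x] /= [Aa Ax] i].
  by split => [|i]; [exact: (Ax ord0)|have := Ax (lift ord0 i); rewrite tnthS].
by have [j ->|->] := unliftP ord0 i; [rewrite tnthS; exact: Ax|].
Qed.

End lebesgue_euclid.
Arguments lebesgue_euclid R n : clear implicits.
Arguments lebesgue_spacetime R n : clear implicits.

Section fractional_heat.
Context {R : realType}.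
Implicit Types (n : nat) (p a : R).

Definition Gamma a : R :=
  \int[@lebesgue_measure R]_(s in `]0, +oo[) (s `^ (a - 1) * expR (- s)).

Definition sqnorm n (x : euclid R n) : R := \sum_(i < n) (tnth x i : R) ^+ 2.

Definition subE n (x y : euclid R n) : euclid R n :=
  [tuple (tnth x i : R) - tnth y i | i < n].

Definition frac_heat_kernel n a (x : euclid R n) (t : R) : R :=
  if 0 < t then
    t `^ (a - 1) / Gamma a * ((4 * pi * t) `^ (n%:R / 2))^-1
      * expR (- (sqnorm x / (4 * t)))
  else 0.

Definition before n (T : R) : set (spacetime R n) := [set w | (w.2 : R) < T].

Definition heat_potential n a (f : spacetime R n -> R)
    (z : spacetime R n) : \bar R :=
  (\int[lebesgue_spacetime R n]_(w in before z.2)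
     (frac_heat_kernel a (subE z.1 w.1) ((z.2 : R) - w.2) * f w)%:E)%E.

(* Functions equal almost everywhere are identified in X^p and Y^p_a; here both
   are sets of functions, and equalities hold almost everywhere. *)
Definition Xspace n p : set (spacetime R n -> R) :=
  [set f : spacetime R n -> R | measurable_fun setT f /\ forall T : R,
     ('N[lebesgue_spacetime R n]_(p%:E) [(EFin \o f) \_ (before T)]
        < +oo)%E].

(* f is a preimage of u under J_a; in particular J_a f is finite almost
   everywhere. *)
Definition heat_potential_of n a (f u : spacetime R n -> R) : Prop :=
  \forall z \ae lebesgue_spacetime R n, (u z)%:E = heat_potential a f z.

Definition Yspace n p a : set (spacetime R n -> R) :=
  [set u | exists2 f, Xspace p f & heat_potential_of a f u].

(* (d_t - Delta)^a : Y^p_a -> X^p, the inverse of J_a : X^p -> Y^p_a; the value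
   at u is a representative of the class in X^p mapped by J_a to that of u. *)
Definition frac_heat n p a (u : spacetime R n -> R) : spacetime R n -> R :=
  xget (cst 0) [set f | Xspace p f /\ heat_potential_of a f u].

Definition admissible n p a : Prop :=
  (1 < p /\ 0 < a < (n%:R + 2) / (2 * p)) \/
  (p = 1 /\ 0 < a <= (n%:R + 2) / (2 * p)).

End fractional_heat.

(* Main.v *)
From HB Require Import structures.
Require Import Defs.
From mathcomp Require Import all_boot all_order all_algebra.
From mathcomp Require Import all_classical all_reals all_analysis.
From mathcomp Require Import measurable_realfun ring lra.

Import Order.TTheory GRing.Theory Num.Theory.
Import numFieldNormedType.Exports.
Local Open Scope classical_set_scope.
Local Open Scope ring_scope.

(** Write [f], [g] for the right-hand sides, so that [u = J_alpha f],
    [v = J_beta g], [f <= v^lam], [g <= u^sig], and put [N = n + 2].  The kernel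
    of [J_alpha], restricted to time lags at most [d], has an [L^s] norm tending
    to [0] with [d] as long as [s (N - 2 alpha) < N].  Young's inequality,
    applied twice, then gives an estimate
    [int f^p <= eta(d) (int f^p)^(lam sig)] on a time slab of length [d] before
    which [f] vanishes, with [eta(d) -> 0].  As [lam sig >= 1] and [int f^p] is
    bounded up to any given time, [f] vanishes on the slab as soon as [d] is
    small, uniformly in the slab, and one marches forward in time.  Admissible
    intermediate exponents exist when [p lam >= 1]; when [p lam < 1] they exist
    after exchanging the roles of the two inequalities. *)

(** * Hölder and Young inequalities *)

(** For [x > 0] this is [ln x <= x - 1], scaled by [a] and exponentiated. At [x = 0] the convention
    [0^0 = 1], [0^a = 0] otherwise, has to be checked by hand. *)
Lemma powR_le_expR (R : realType) (a x : R) :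
  0 <= a -> 0 <= x -> x `^ a <= expR (a * (x - 1)).
Proof.
move=> a0; rewrite le_eqVlt => /predU1P[<-|x0].
  have [->|an0] := eqVneq a 0; first by rewrite powRr0 mul0r expR0.
  by rewrite powR0// expR_ge0.
rewrite /powR gt_eqF// ler_expR ler_wpM2l//.
have := @le_ln1Dx R (x - 1).
by rewrite (_ : 1 + (x - 1) = x); [apply; lra|ring].
Qed.

(** Both sides are homogeneous of degree 1, so one may divide [x], [y], [z] by the weighted mean
    [S]. The three exponential bounds then multiply to [expR 0]. *)
Lemma weighted_amgm3 (R : realType) (a b c x y z : R) :
  0 <= a -> 0 <= b -> 0 <= c -> a + b + c = 1 ->
  0 <= x -> 0 <= y -> 0 <= z ->
  x `^ a * y `^ b * z `^ c <= a * x + b * y + c * z.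
Proof.
move=> a0 b0 c0 abc x0 y0 z0.
set S := a * x + b * y + c * z.
have ax0 : 0 <= a * x by exact: mulr_ge0.
have by0 : 0 <= b * y by exact: mulr_ge0.
have cz0 : 0 <= c * z by exact: mulr_ge0.
have : 0 <= S by rewrite !addr_ge0.
(* If [S = 0], each weighted term vanishes; the weights sum to 1, so some weight is nonzero and its
   variable is 0, which kills the product. *)
rewrite le_eqVlt => /predU1P[S0|S0].
  have powR_eq0_of (d w : R) : d != 0 -> d * w = 0 -> w `^ d = 0.
    by move=> d0 /eqP; rewrite mulf_eq0 (negbTE d0)/= => /eqP ->; exact: powR0.
  have [ax by' cz] : [/\ a * x = 0, b * y = 0 & c * z = 0].
    by move: S0; rewrite /S => S0; split; lra.
  rewrite -S0; have [a00|an0] := eqVneq a 0; last first.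
    by rewrite (powR_eq0_of a)// !mul0r.
  have [b00|bn0] := eqVneq b 0; last by rewrite (powR_eq0_of b)// mulr0 mul0r.
  by rewrite (powR_eq0_of c) ?mulr0//; apply/eqP => c00; lra.
have xS (w : R) : w = S * (w / S) by rewrite mulrC divfK// gt_eqF.
have wS (w : R) : 0 <= w -> 0 <= w / S by move=> w0; rewrite divr_ge0// ltW.
rewrite {1}(xS x) {1}(xS y) {1}(xS z).
rewrite (powRM a (ltW S0) (wS _ x0)) (powRM b (ltW S0) (wS _ y0)).
rewrite (powRM c (ltW S0) (wS _ z0)).
have -> : S `^ a * (x / S) `^ a * (S `^ b * (y / S) `^ b) *
    (S `^ c * (z / S) `^ c) =
    (S `^ a * S `^ b * S `^ c) * ((x / S) `^ a * (y / S) `^ b * (z / S) `^ c).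
  by ring.
rewrite -!powRD ?(gt_eqF S0) ?implybT// abc powRr1 ?(ltW S0)//.
rewrite ler_piMr ?(ltW S0)//.
apply: (@le_trans _ _ (expR (a * (x / S - 1)) * expR (b * (y / S - 1)) *
    expR (c * (z / S - 1)))).
  by rewrite !ler_pM ?mulr_ge0 ?powR_ge0 ?powR_le_expR ?wS.
rewrite -!expRD -[leRHS]expR0 ler_expR le_eqVlt; apply/orP; left; apply/eqP.
have -> : a * (x / S - 1) + b * (y / S - 1) + c * (z / S - 1) =
  S / S - (a + b + c) by rewrite /S; ring.
by rewrite abc divff ?subrr// gt_eqF.
Qed.

(* Zero weights are allowed: they occur at the endpoint exponents [r = p] and
   [p = 1] of Young's inequality. *)
Lemma hoelder3 d (T : measurableType d) (R : realType)
    (mu : {measure set T -> \bar R}) (F x y z : T -> R) (a b c X Y Z : R) :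
  measurable_fun setT F -> measurable_fun setT x -> measurable_fun setT y ->
  measurable_fun setT z ->
  (forall t, 0 <= F t) -> (forall t, 0 <= x t) -> (forall t, 0 <= y t) ->
  (forall t, 0 <= z t) ->
  0 <= a -> 0 <= b -> 0 <= c -> a + b + c = 1 ->
  0 < X -> 0 < Y -> 0 < Z ->
  (\int[mu]_t (x t)%:E <= X%:E)%E ->
  (\int[mu]_t (y t)%:E <= Y%:E)%E ->
  (\int[mu]_t (z t)%:E <= Z%:E)%E ->
  (forall t, F t <= x t `^ a * y t `^ b * z t `^ c) ->
  (\int[mu]_t (F t)%:E <= (X `^ a * Y `^ b * Z `^ c)%:E)%E.
Proof.
move=> mF mx my mz F0 x0 y0 z0 a0 b0 c0 abc X0 Y0 Z0 xX yY zZ Fxyz.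
set C := X `^ a * Y `^ b * Z `^ c.
have C0 : 0 <= C by rewrite !mulr_ge0 ?powR_ge0.
have wX0 (W w : R) : 0 < W -> 0 <= w -> 0 <= w / W.
  by move=> W0 w0; rewrite divr_ge0// ltW.
(* Weighted AM-GM applied to [x/X], [y/Y], [z/Z] bounds [F] by [x1 + y1 + z1], whose integral is at
   most [C (a + b + c) = C]. *)
pose x1 t := (C * a / X * x t)%R; pose y1 t := (C * b / Y * y t)%R.
pose z1 t := (C * c / Z * z t)%R.
have Fle t : ((F t)%:E <= (x1 t)%:E + (y1 t)%:E + (z1 t)%:E)%E.
  rewrite -!EFinD lee_fin (le_trans (Fxyz t))//.
  have EW (W w : R) : 0 < W -> w = W * (w / W).
    by move=> W0; rewrite mulrC divfK// gt_eqF.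
  rewrite {1}(EW X (x t))// {1}(EW Y (y t))// {1}(EW Z (z t))//.
  rewrite (powRM a (ltW X0) (wX0 _ _ X0 (x0 t))).
  rewrite (powRM b (ltW Y0) (wX0 _ _ Y0 (y0 t))).
  rewrite (powRM c (ltW Z0) (wX0 _ _ Z0 (z0 t))).
  have -> : X `^ a * (x t / X) `^ a * (Y `^ b * (y t / Y) `^ b) *
     (Z `^ c * (z t / Z) `^ c) =
     C * ((x t / X) `^ a * (y t / Y) `^ b * (z t / Z) `^ c) by rewrite /C; ring.
  have -> : x1 t + y1 t + z1 t =
     C * (a * (x t / X) + b * (y t / Y) + c * (z t / Z)).
    by rewrite /x1 /y1 /z1; ring.
  by rewrite ler_wpM2l// weighted_amgm3// wX0.
have mw (k : R) (w : T -> R) : measurable_fun setT w ->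
    measurable_fun setT (EFin \o (fun t => k * w t)).
  by move=> mw; apply/measurable_EFinP; exact: measurable_funM.
have kW (k W : R) (w : T -> R) : measurable_fun setT w ->
    (forall t, 0 <= w t) -> 0 <= k -> 0 < W ->
    (\int[mu]_t (w t)%:E <= W%:E)%E ->
    (\int[mu]_t (k / W * w t)%:E <= k%:E)%E.
  move=> mw' w0 k0 W0 wW.
  under eq_integral do rewrite EFinM.
  rewrite ge0_integralZl//=.
  - rewrite (@le_trans _ _ ((k / W)%:E * W%:E)%E)//.
      by rewrite lee_wpmul2l// lee_fin wX0.
    by rewrite -EFinM divfK// gt_eqF.
  - exact/measurable_EFinP.
  - by move=> t _; rewrite lee_fin.
  - by rewrite lee_fin wX0.
have Ca0 (e : R) : 0 <= e -> 0 <= C * e by move=> e0; exact: mulr_ge0.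
have ge0 (k W : R) (w : T -> R) t : 0 <= k -> 0 < W -> (forall t, 0 <= w t) ->
    (0 <= (k / W * w t)%:E)%E.
  by move=> k0 W0 w0; rewrite lee_fin mulr_ge0// wX0.
apply: (@le_trans _ _
    (\int[mu]_t ((x1 t)%:E + (y1 t)%:E + (z1 t)%:E))%E).
  apply: ge0_le_integral => //.
  - by move=> t _; rewrite lee_fin.
  - exact/measurable_EFinP.
  - by apply: emeasurable_funD; [apply: emeasurable_funD|]; exact: mw.
rewrite ge0_integralD//=; last 4 first.
- by move=> t _; rewrite adde_ge0// ge0// Ca0.
- by apply: emeasurable_funD; exact: mw.
- by move=> t _; rewrite ge0// Ca0.
- exact: mw.
rewrite ge0_integralD//=; last 4 first.
- by move=> t _; rewrite ge0// Ca0.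
- exact: mw.
- by move=> t _; rewrite ge0// Ca0.
- exact: mw.
apply: (@le_trans _ _ ((C * a)%:E + (C * b)%:E + (C * c)%:E)%E).
  by rewrite !leeD// kW// Ca0.
by rewrite -!EFinD -!mulrDr abc mulr1.
Qed.

(* Split [k f = (k^s f^p)^(1/r) (k^s)^(1/s-1/r) (f^p)^(1/p-1/r)]. *)
Lemma young_integral_operator d (T : measurableType d) (R : realType)
    (mu : {sigma_finite_measure set T -> \bar R}) (k : T * T -> R) (f : T -> R)
    (p r s A M : R) :
  measurable_fun setT k -> measurable_fun setT f ->
  (forall z, 0 <= k z) -> (forall w, 0 <= f w) ->
  0 < p -> p <= r -> 0 < s -> s <= r -> 1 + r^-1 = p^-1 + s^-1 ->
  0 < A -> 0 < M ->
  (forall z, \int[mu]_w (k (z, w) `^ s)%:E <= A%:E)%E ->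
  (forall w, \int[mu]_z (k (z, w) `^ s)%:E <= A%:E)%E ->
  (\int[mu]_w (f w `^ p)%:E <= M%:E)%E ->
  (\int[mu]_z (\int[mu]_w (k (z, w) * f w)%:E) `^ r <=
     (A `^ (r / s) * M `^ (r / p))%:E)%E.
Proof.
move=> mk mf k0 f0 p0 pr s0 sr e A0 M0 kA kA' fM.
have r0 : 0 < r by exact: lt_le_trans p0 pr.
set a := r^-1; set b := s^-1 - r^-1; set c := p^-1 - r^-1.
have a0 : 0 < a by rewrite invr_gt0.
have b0 : 0 <= b by rewrite subr_ge0 lef_pV2.
have c0 : 0 <= c by rewrite subr_ge0 lef_pV2.
have abc : a + b + c = 1 by rewrite /a /b /c; lra.
pose g (zw : T * T) := k zw `^ s * f zw.2 `^ p.
have mks : measurable_fun setT (fun zw => k zw `^ s).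
  exact: (measurableT_comp (measurable_powR s) mk).
have mfp : measurable_fun setT (fun w => f w `^ p).
  exact: (measurableT_comp (measurable_powR p) mf).
have mfp2 : measurable_fun setT (fun zw : T * T => f zw.2 `^ p).
  exact: (measurableT_comp mfp measurable_snd).
have mg : measurable_fun setT g by exact: measurable_funM.
have g0 zw : 0 <= g zw by rewrite mulr_ge0 ?powR_ge0.
pose G z := (\int[mu]_w (g (z, w))%:E)%E.
have mG : measurable_fun setT G.
  apply: (measurable_fun_fubini_tonelli_F (EFin \o g)).
    exact/measurable_EFinP.
  by move=> zw; rewrite lee_fin.
have G0 z : (0 <= G z)%E by apply: integral_ge0 => w _; rewrite lee_fin.
have sect z (h : T * T -> R) : measurable_fun setT h ->
    measurable_fun setT (fun w => h (z, w)).
  by move=> mh; exact: (measurableT_comp mh (measurable_pair1 z)).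
pose B := A `^ b * M `^ c.
have B0 : 0 < B by rewrite mulr_gt0 ?powR_gt0.
(* Hölder for fixed [z], against an arbitrary positive upper bound [X] of [G z], since [G z] itself
   may be 0 or infinite. *)
have JX z X : 0 < X -> (G z <= X%:E)%E ->
    (\int[mu]_w (k (z, w) * f w)%:E <= (X `^ a * B)%:E)%E.
  move=> X0 GX; rewrite /B mulrA.
  apply: (@hoelder3 _ _ _ mu _ (fun w => g (z, w)) (fun w => k (z, w) `^ s)
    (fun w => f w `^ p)) => //.
  - by apply: measurable_funM => //; exact: sect.
  - exact: sect.
  - exact: (sect z _ mks).
  - by move=> w; exact: mulr_ge0.
  - by move=> w; exact: powR_ge0.
  - by move=> w; exact: powR_ge0.
  - exact: ltW.
  move=> w; rewrite /g powRM ?powR_ge0// -!powRrM.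
  have -> : k (z, w) `^ (s * a) * f w `^ (p * a) * k (z, w) `^ (s * b) *
    f w `^ (p * c) = (k (z, w) `^ (s * a) * k (z, w) `^ (s * b)) *
    (f w `^ (p * a) * f w `^ (p * c)) by ring.
  have sab : s * a + s * b = 1.
    by rewrite -mulrDr /a /b addrC subrK divff// gt_eqF.
  have pac : p * a + p * c = 1.
    by rewrite -mulrDr /a /c addrC subrK divff// gt_eqF.
  by rewrite -!powRD ?sab ?pac ?oner_eq0// !powRr1.
have Jr z : ((\int[mu]_w (k (z, w) * f w)%:E) `^ r <= (B `^ r)%:E * G z)%E.
  have : (0 <= G z)%E := G0 z.
  case E : (G z) => [x| |]// x0; last first.
    by rewrite gt0_muley ?leey// lte_fin powR_gt0.
  (* The increment [eps / B^r] makes [X] positive and costs exactly [eps] after raising to the power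
     [r]. *)
  apply/lee_addgt0Pr => eps eps0.
  have Br0 : 0 < B `^ r by rewrite powR_gt0.
  pose X := x + eps / B `^ r.
  have X0 : 0 < X.
    by rewrite ltr_wpDl// ?divr_gt0//.
  have /(JX z X X0) J : (G z <= X%:E)%E.
    by rewrite E lee_fin lerDl ltW// divr_gt0.
  apply: (@le_trans _ _ (((X `^ a * B) `^ r)%:E)).
    rewrite -poweR_EFin; apply: gt0_ler_poweR => //; first exact: ltW.
    - rewrite in_itv/= leey andbT; apply: integral_ge0 => w _.
      by rewrite lee_fin mulr_ge0.
    - by rewrite in_itv/= leey andbT lee_fin mulr_ge0 ?powR_ge0// ltW.
  rewrite -EFinM -EFinD lee_fin powRM ?powR_ge0 ?(ltW B0)//.
  rewrite -powRrM mulVf ?gt_eqF// powRr1 ?(ltW X0)// /X.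
  by rewrite mulrDl divfK ?gt_eqF// mulrC.
have mJ : measurable_fun setT (fun z => \int[mu]_w (k (z, w) * f w)%:E)%E.
  apply: (measurable_fun_fubini_tonelli_F (EFin \o (fun zw => k zw * f zw.2))).
    apply/measurable_EFinP; apply: measurable_funM => //.
    exact: measurableT_comp.
  by move=> zw; rewrite lee_fin mulr_ge0.
apply: (@le_trans _ _ (\int[mu]_z ((B `^ r)%:E * G z))%E).
  apply: ge0_le_integral => //.
  - by move=> z _; exact: poweR_ge0.
  - exact: (measurableT_comp (measurable_poweR _)).
  - exact: emeasurable_funM.
rewrite ge0_integralZl//=; last by rewrite lee_fin powR_ge0.
(* Tonelli: integrating first in [z] uses the column bound on [k^s]; the row bound went into Hölder
   above. *)
have GAM : (\int[mu]_z G z <= (A * M)%:E)%E.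
  have mEg : measurable_fun setT (EFin \o g) by exact/measurable_EFinP.
  have Eg0 zw : (0 <= (EFin \o g) zw)%E by rewrite lee_fin.
  have -> : (\int[mu]_z G z = \int[mu]_w \int[mu]_z (g (z, w))%:E)%E.
    exact: (fubini_tonelli _ mEg Eg0).
  apply: (@le_trans _ _ (\int[mu]_w (A%:E * (f w `^ p)%:E))%E).
    apply: ge0_le_integral => //.
    - by move=> w _; apply: integral_ge0 => z _; rewrite lee_fin.
    - apply: (measurable_fun_fubini_tonelli_G (EFin \o g)).
        exact/measurable_EFinP.
      by move=> zw; rewrite lee_fin.
    - by apply: emeasurable_funM => //; exact/measurable_EFinP.
    move=> w _; rewrite /g.
    under eq_integral do rewrite mulrC EFinM /=.
    rewrite ge0_integralZl//=.
    - by rewrite muleC lee_wpmul2r// lee_fin powR_ge0.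
    - by apply/measurable_EFinP; apply: (measurableT_comp mks).
    - by move=> z _; rewrite lee_fin powR_ge0.
    - by rewrite lee_fin powR_ge0.
  rewrite ge0_integralZl//=.
  - by rewrite EFinM lee_wpmul2l// lee_fin ltW.
  - exact/measurable_EFinP.
  - by move=> w _; rewrite lee_fin powR_ge0.
  - by rewrite lee_fin ltW.
apply: (@le_trans _ _ ((B `^ r)%:E * (A * M)%:E)%E).
  by rewrite lee_wpmul2l// lee_fin powR_ge0.
rewrite -EFinM lee_fin /B powRM ?powR_ge0// -!powRrM.
have -> : r / s = b * r + 1 by rewrite /b mulrBl mulVf ?gt_eqF// mulrC subrK.
have -> : r / p = c * r + 1 by rewrite /c mulrBl mulVf ?gt_eqF// mulrC subrK.
have br0 : 0 <= b * r by rewrite mulr_ge0// ltW.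
have cr0 : 0 <= c * r by rewrite mulr_ge0// ltW.
rewrite !powRD ?(gt_eqF A0) ?(gt_eqF M0) ?implybT//.
rewrite !powRr1 ?(ltW A0) ?(ltW M0)//.
by rewrite le_eqVlt; apply/orP; left; apply/eqP; ring.
Qed.

(** * Gaussian and power integrals *)

(** Translations and reflections preserve the length of intervals, hence Lebesgue measure by
    uniqueness. The bit [b] treats both at once: time lags occur as [t - r] and as [r - t]. *)
Lemma ge0_integral_affine_isometry (R : realType) (b : bool) (t : R)
    (f : R -> \bar R) :
  measurable_fun setT f -> (forall x, (0 <= f x)%E) ->
  (\int[lebesgue_measure]_x f ((-1) ^+ b * x + t)%R =
   \int[lebesgue_measure]_x f x)%E.
Proof.
move=> mf f0.
pose phi : measurableTypeR R -> measurableTypeR R := fun x => (-1) ^+ b * x + t.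
have mphi : measurable_fun setT phi by exact: measurable_funD.
pose mfphi := isMeasurableFun.Build _ _ _ _ _ mphi.
pose Phi : {mfun _ >-> _} := HB.pack phi mfphi.
have E A : measurable A ->
    lebesgue_measure A = pushforward (@lebesgue_measure R) Phi A.
  apply: lebesgue_measure_unique => //= _ [[u v]] _ <-.
  rewrite /pushforward /=.
  have [phiE|phiE] :
      (forall x, phi x = t - x :> R) \/ (forall x, phi x = x + t :> R).
    by rewrite /phi; case: (b); [left|right] => x /=; ring.
  (* A reflection exchanges the open and the closed end; the length is unaffected. *)
  - have -> : phi @^-1` `]u, v] = `[t - v, t - u[%classic.
      by apply/seteqP; split => x/=; rewrite phiE !in_itv/=; lra.
    rewrite !lebesgue_measure_itv/= !lte_fin.
    have -> : (t - v < t - u) = (u < v) by apply/idP/idP; lra.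
    by case: ifP => // _; rewrite -!EFinD; congr EFin; lra.
  - have -> : phi @^-1` `]u, v] = `]u - t, v - t]%classic.
      by apply/seteqP; split => x/=; rewrite phiE !in_itv/=; lra.
    rewrite !lebesgue_measure_itv/= !lte_fin.
    have -> : (u - t < v - t) = (u < v) by apply/idP/idP; lra.
    by case: ifP => // _; rewrite -!EFinD; congr EFin; lra.
rewrite (_ : (\int[lebesgue_measure]_x f x =
  \int[pushforward (@lebesgue_measure R) Phi]_x f x)%E); last first.
  by apply: eq_measure_integral => // A mA _; exact: E.
by rewrite (ge0_integral_pushforward mphi).
Qed.

Section gauss.
Context {R : realType}.
Local Open Scope ereal_scope.

Lemma measurable_prod_normal_pdf (n : nat) (x : euclid R n) (s : R) :
  measurable_fun setT (fun y : euclid R n =>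
    \prod_(i < n) normal_pdf (tnth x i) s (tnth y i))%R.
Proof.
apply: measurable_prod => i _.
apply: (measurableT_comp (measurable_normal_pdf _ _)).
exact: measurable_tnth.
Qed.

(** Induction on the dimension: the measure on [R^(n+1)] is an image of a product, so Tonelli splits
    off the first density. In dimension 0 it is a Dirac mass and the product is empty. *)
Lemma integral_prod_normal_pdf (n : nat) (x : euclid R n) (s : R) :
  \int[lebesgue_euclid R n]_y
    (\prod_(i < n) normal_pdf (tnth x i) s (tnth y i))%:E = 1.
Proof.
elim: n x => [|n IHn] x.
  rewrite integral_dirac//=.
    by rewrite diracT big_ord0 mul1e.
  by apply/measurable_EFinP; exact: measurable_prod_normal_pdf.
pose F (y : euclid R n.+1) :=
  (\prod_(i < n.+1) normal_pdf (tnth x i) s (tnth y i))%:E : \bar R.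
have mF : measurable_fun setT F.
  by apply/measurable_EFinP; exact: measurable_prod_normal_pdf.
have F0 y : 0 <= F y.
  by rewrite lee_fin prodr_ge0// => i _; exact: normal_pdf_ge0.
transitivity (\int[pushforward (@lebesgue_measure R \x lebesgue_euclid R n)
    (@consE R n)]_y F y); first by [].
rewrite (ge0_integral_pushforward (@measurable_consE R n))//.
pose x' := [tuple of behead x].
pose g (z : measurableTypeR R * euclid R n) := F (consE z).
have mg : measurable_fun setT g.
  exact: (measurableT_comp mF (@measurable_consE R n)).
have gE a y : g (a, y) = (normal_pdf (tnth x ord0) s a *
    \prod_(i < n) normal_pdf (tnth x' i) s (tnth y i))%:E.
  rewrite /g /F big_ord_recl; congr (EFin (_ * _)%R).
  apply: eq_bigr => i _; rewrite /consE tnthS /x' tnth_behead.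
  suff -> : inord i.+1 = lift ord0 i by [].
  by apply/val_inj; rewrite /= inordK// ltnS.
rewrite preimage_setT (fubini_tonelli1 g mg)//; last by move=> z; exact: F0.
rewrite /fubini_F.
transitivity (\int[@lebesgue_measure R]_a (normal_pdf (tnth x ord0) s a)%:E).
  apply: eq_integral => a _.
  under eq_integral do rewrite gE EFinM.
  rewrite /= ge0_integralZl//=.
  - by rewrite IHn mule1.
  - by apply/measurable_EFinP; exact: measurable_prod_normal_pdf.
  - by move=> y _; rewrite lee_fin prodr_ge0// => i _; exact: normal_pdf_ge0.
  - by rewrite lee_fin normal_pdf_ge0.
exact: integral_normal_pdf.
Qed.

End gauss.

Lemma continuous_powR (R : realType) (b x : R) :
  0 < x -> {for x, continuous (fun y : R => y `^ b)}.
Proof.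
move=> x0; apply: differentiable_continuous; apply/derivable1_diffP.
by apply: derivable_powR; rewrite in_itv/= x0.
Qed.

Lemma integral_powR_itv (R : realType) (e c d : R) : 0 < e -> 0 < c -> c < d ->
  (\int[lebesgue_measure]_(t in `[c, d]) (t `^ (e - 1))%:E =
   (d `^ e / e - c `^ e / e)%:E)%E.
Proof.
move=> e0 c0 cd.
have pos (x : R) : x \in `[c, d] -> (0 < x)%R.
  by rewrite in_itv/= => /andP[+ _]; exact: lt_le_trans.
pose F (t : R) := t `^ e * e^-1.
have cF (x : R) : (0 < x)%R -> {for x, continuous F}.
  by move=> x0; apply: cvgMr_tmp; exact: continuous_powR.
have dF (x : R) : 0 < x -> is_derive x 1 F (x `^ (e - 1)).
  move=> x0; have := @is_derive1_powR R e x x0 => H.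
  apply: (is_derive_eq (is_deriveM H (is_derive_cst _ _ _))).
by rewrite scaler0 add0r /GRing.scale/= mulrA mulVf ?mul1r// gt_eqF.
rewrite EFinB; apply: (@continuous_FTC2 _ _ F) => //.
- apply: continuous_in_subspaceT => x /set_mem/pos.
  exact: continuous_powR.
- split.
  + move=> x xd; apply: (@ex_derive _ _ _ _ _ _ _ (dF _ _)); apply: pos.
    exact: subset_itv_oo_cc.
  + by apply: cvg_at_right_filter; apply: cF.
  + by apply: cvg_at_left_filter; apply: cF; exact: lt_trans cd.
- move=> x xd.
  have x0 : (0 < x)%R by apply: pos; exact: subset_itv_oo_cc.
  rewrite derive1E.
  exact: (@derive_val _ _ _ _ _ _ _ (dF _ x0)).
Qed.

Section powR_integral.
Context {R : realType}.
Local Open Scope ereal_scope.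
(** The integrand may blow up at 0, so the interval is exhausted by compact ones and monotone
    convergence is used; dropping the lower endpoint term leaves an upper bound. *)
Lemma integral_powR_le (e d : R) : (0 < e)%R -> (0 < d)%R ->
  \int[lebesgue_measure]_(t in `]0%R, d]) (t `^ (e - 1))%:E <= (d `^ e / e)%:E.
Proof.
move=> e0 d0.
(* With [n + 2] the left endpoint is strictly below [d] already at [n = 0], as [integral_powR_itv]
   demands. *)
pose F (n : nat) : set R := `[(d / (n.+2%:R))%R, d]%classic.
have dn (n : nat) : (0 < d / n.+2%:R)%R by rewrite divr_gt0.
have UF : `]0%R, d]%classic = \bigcup_n F n.
  apply/seteqP; split => [x|x [n _]]; rewrite /F /= !in_itv/=.
    move=> /andP[x0 xd].
    pose n := Num.truncn (d / x).
    exists n => //; rewrite /F /= in_itv/= xd andbT.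
    rewrite ler_pdivrMr// mulrC -ler_pdivrMr//.
    have := truncnS_gt (d / x).
    by move=> /ltW/le_trans; apply; rewrite ler_nat.
  by move=> /andP[nx ->]; rewrite andbT (lt_le_trans (dn n)).
have mp : measurable_fun setT (fun t : R => (t `^ (e - 1))%:E).
  by apply/measurable_EFinP; exact: measurable_powR.
have cvgF : \int[lebesgue_measure]_(x in F n) (x `^ (e - 1))%:E @[n --> \oo]
    --> \int[lebesgue_measure]_(t in `]0%R, d]) (t `^ (e - 1))%:E.
  rewrite UF; apply: ge0_nondecreasing_set_cvg_integral.
  - apply/nondecreasing_seqP => n; apply/subsetPset => x.
    rewrite /F/= !in_itv/= => /andP[h ->]; rewrite andbT (le_trans _ h)//.
    by rewrite ler_pM2l// lef_pV2 ?posrE// ler_nat.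
  - by move=> n; exact: measurable_itv.
  - by move=> n; exact: measurable_funTS.
  - by move=> n x _; rewrite lee_fin powR_ge0.
rewrite -(cvg_lim _ cvgF)//.
apply: lime_le; first by apply/cvg_ex; eexists; exact: cvgF.
apply: nearW => n.
rewrite /F integral_powR_itv//; last first.
  by rewrite ltr_pdivrMr// ltr_pMr// ltr1n.
by rewrite lee_fin lerBlDr lerDl divr_ge0 ?powR_ge0// ltW.
Qed.
End powR_integral.

(** * The heat kernel for short time lags *)

Section kernel.
Context {R : realType} (n : nat).
Implicit Types (a s t : R) (x y : euclid R n).

Lemma Gamma_ge0 a : 0 <= Gamma a.
Proof.
rewrite /Gamma /Rintegral fine_ge0// integral_ge0// => x _.
by rewrite lee_fin mulr_ge0 ?powR_ge0 ?expR_ge0.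
Qed.

Lemma frac_heat_kernel_ge0 a x t : 0 <= frac_heat_kernel a x t.
Proof.
rewrite /frac_heat_kernel; case: ifPn => // t0.
by rewrite !mulr_ge0 ?powR_ge0 ?invr_ge0 ?Gamma_ge0 ?powR_ge0 ?expR_ge0.
Qed.

Lemma sqnorm_subE x y :
  sqnorm (subE x y) = \sum_(i < n) ((tnth x i : R) - tnth y i) ^+ 2.
Proof. by apply: eq_bigr => i _; rewrite tnth_mktuple. Qed.

Lemma sqnorm_subEC x y : sqnorm (subE x y) = sqnorm (subE y x).
Proof.
by rewrite !sqnorm_subE; apply: eq_bigr => i _; rewrite -sqrrN opprB.
Qed.

Lemma sqnorm_ge0 x : 0 <= sqnorm x.
Proof. by apply: sumr_ge0 => i _; exact: sqr_ge0. Qed.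

Lemma frac_heat_kernelC a x y t :
  frac_heat_kernel a (subE x y) t = frac_heat_kernel a (subE y x) t.
Proof. by rewrite /frac_heat_kernel sqnorm_subEC. Qed.

(** The Gauss kernel at time [t] is the density of independent normal variables of variance [2t], so
    its mass is known. *)
Lemma prod_normal_pdfE x y t : 0 < t ->
  \prod_(i < n) normal_pdf (tnth x i) (Num.sqrt (2 * t)) (tnth y i) =
  ((4 * pi * t) `^ (n%:R / 2))^-1 * expR (- (sqnorm (subE x y) / (4 * t))).
Proof.
move=> t0.
have s0 : Num.sqrt (2 * t) != 0 by rewrite sqrtr_eq0 -ltNge mulr_gt0.
under eq_bigr do rewrite normal_pdfE//.
rewrite big_split/= prodr_const card_ord -expR_sum; congr (_ * expR _).
- rewrite /normal_peak exprVn sqr_sqrtr; last by rewrite mulr_ge0// ltW.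
  congr (_^-1); rewrite (mulrC n%:R) powRrM.
  have pt : 0 <= 4 * pi * t by rewrite !mulr_ge0 ?pi_ge0// ltW.
  rewrite powR12_sqrt// powR_mulrn ?sqrtr_ge0//.
  by congr (Num.sqrt _ ^+ _); rewrite -mulr_natr; ring.
- rewrite sqnorm_subE mulr_suml -sumrN; apply: eq_bigr => i _.
  rewrite sqr_sqrtr; last by rewrite mulr_ge0// ltW.
  rewrite -mulr_natr mulNr; congr (- (_ / _)); [|by ring].
  by rewrite -sqrrN opprB.
Qed.

(** One factor of the Gaussian is kept as a probability density and the other [s - 1] are bounded by
    its peak. What remains is a power of [t], so no rescaled Gaussian has to be integrated. *)
Lemma frac_heat_kernel_powR_le a s x y t : 1 <= s -> 0 < t ->
  frac_heat_kernel a (subE x y) t `^ s <=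
  (((Gamma a)^-1 `^ s * (4 * pi) `^ (- (n%:R / 2 * (s - 1)))) *
    t `^ ((a - 1) * s - n%:R / 2 * (s - 1))) *
  \prod_(i < n) normal_pdf (tnth x i) (Num.sqrt (2 * t)) (tnth y i).
Proof.
move=> s1 t0; rewrite prod_normal_pdfE// /frac_heat_kernel t0.
set P := ((4 * pi * t) `^ (n%:R / 2))^-1; set E := expR _.
have P0 : 0 < P by rewrite invr_gt0 powR_gt0// !mulr_gt0// pi_gt0.
have E0 : 0 < E by exact: expR_gt0.
have E1 : E <= 1.
  rewrite -[leRHS]expR0 ler_expR oppr_le0 divr_ge0 ?sqnorm_ge0// mulr_ge0//.
  exact: ltW.
have s0 : 0 <= s by lra.
have PE : 0 < P * E by exact: mulr_gt0.
rewrite -mulrA powRM ?(ltW PE)//; last first.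
  by rewrite mulr_ge0 ?powR_ge0// invr_ge0 Gamma_ge0.
rewrite powRM ?powR_ge0 ?invr_ge0 ?Gamma_ge0//.
(* Here [P] is the peak of the Gaussian and [E <= 1] its profile. *)
have PEs : (P * E) `^ s <= P `^ (s - 1) * (P * E).
  rewrite -[leLHS]mulr_powRB1 ?(ltW PE)//; last by lra.
  rewrite mulrC.
  rewrite ler_wpM2r ?(ltW PE)//.
  rewrite ge0_ler_powR ?nnegrE ?subr_ge0 ?(ltW P0) ?(ltW PE)//.
  by rewrite ler_piMr// ltW.
have PsE : P `^ (s - 1) =
    (4 * pi) `^ (- (n%:R / 2 * (s - 1))) * t `^ (- (n%:R / 2 * (s - 1))).
  rewrite -powRM; [|by rewrite mulr_ge0// pi_ge0|exact: ltW].
  by rewrite powRN powRrM /P -powR_inv1 ?powR_ge0// powRAC powR_inv1 ?powR_ge0.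
apply: (@le_trans _ _ ((t `^ (a - 1)) `^ s * (Gamma a)^-1 `^ s *
    (P `^ (s - 1) * (P * E)))).
  by rewrite ler_wpM2l// mulr_ge0 ?powR_ge0.
rewrite PsE -powRrM powRD ?(gt_eqF t0) ?implybT//.
by rewrite le_eqVlt; apply/orP; left; apply/eqP; ring.
Qed.

End kernel.

(** A function of the pair of points, as in [young_integral_operator]. Lags at most 0 contribute
    nothing, so the support in the lag is []0, d]]. *)
Definition short_time_kernel (R : realType) (n : nat) (a d : R)
    (zw : spacetime R n * spacetime R n) : R :=
  if (zw.1.2 : R) - zw.2.2 <= d
  then frac_heat_kernel a (subE zw.1.1 zw.2.1) ((zw.1.2 : R) - zw.2.2) else 0.

(** * Measurability and mass of the short-time kernel *)

Section short_time.
Context {R : realType} (n : nat).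
Implicit Types (a s t d : R).

Lemma measurable_sqnorm_sub :
  measurable_fun setT (fun zw : spacetime R n * spacetime R n =>
    sqnorm (subE zw.1.1 zw.2.1)).
Proof.
rewrite (_ : (fun _ => _) = (fun zw : spacetime R n * spacetime R n =>
    \sum_(i < n) ((tnth zw.1.1 i : R) - tnth zw.2.1 i) ^+ 2)); last first.
  by apply/funext => zw; rewrite sqnorm_subE.
apply: measurable_sum => i; apply: measurable_funX; apply: measurable_funB.
- apply: (measurableT_comp (measurable_tnth i)).
  exact: (measurableT_comp measurable_fst measurable_fst).
- apply: (measurableT_comp (measurable_tnth i)).
  exact: (measurableT_comp measurable_fst measurable_snd).
Qed.

Lemma measurable_time_lag :
  measurable_fun setT (fun zw : spacetime R n * spacetime R n =>
    (zw.1.2 : R) - zw.2.2).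
Proof.
apply: measurable_funB.
- exact: (measurableT_comp measurable_snd measurable_fst).
- exact: (measurableT_comp measurable_snd measurable_snd).
Qed.

Lemma measurable_frac_heat_kernel a :
  measurable_fun setT (fun zw : spacetime R n * spacetime R n =>
    frac_heat_kernel a (subE zw.1.1 zw.2.1) ((zw.1.2 : R) - zw.2.2)).
Proof.
(* Reciprocals become real powers, so that measurability follows by composition. *)
rewrite (_ : (fun _ => _) = fun zw : spacetime R n * spacetime R n =>
    if 0 < (zw.1.2 : R) - zw.2.2 then
      ((zw.1.2 : R) - zw.2.2) `^ (a - 1) / Gamma a *
      (4 * pi * ((zw.1.2 : R) - zw.2.2)) `^ (- (n%:R / 2)) *
      expR (- (sqnorm (subE zw.1.1 zw.2.1) *
               (4 * ((zw.1.2 : R) - zw.2.2)) `^ (- 1)))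
    else 0); last first.
  apply/funext => zw; rewrite /frac_heat_kernel; case: ifPn => // t0.
  by rewrite powRN powR_inv1// mulr_ge0// ltW.
have mt := measurable_time_lag.
apply: measurable_fun_ifT => //; first exact: measurable_fun_ltr.
apply: measurable_funM.
  apply: measurable_funM.
    apply: measurable_funM => //.
    exact: (measurableT_comp (measurable_powR _) mt).
  by apply: (measurableT_comp (measurable_powR _)); exact: measurable_funM.
apply: measurableT_comp => //; apply: measurableT_comp => //.
apply: measurable_funM; first exact: measurable_sqnorm_sub.
by apply: (measurableT_comp (measurable_powR _)); exact: measurable_funM.
Qed.

Lemma measurable_short_time_kernel a d :
  measurable_fun setT (@short_time_kernel R n a d).
Proof.
apply: measurable_fun_ifT => //; last exact: measurable_frac_heat_kernel.
by apply: measurable_fun_ler => //; exact: measurable_time_lag.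
Qed.

Lemma short_time_kernel_ge0 a d zw : 0 <= @short_time_kernel R n a d zw.
Proof.
by rewrite /short_time_kernel; case: ifP => // _; exact: frac_heat_kernel_ge0.
Qed.

(** What [frac_heat_kernel_powR_le] leaves of the [s]-th power of the kernel once the normal
    densities are integrated out in space. *)
Definition kernel_power_bound a s (d t : R) : R :=
  ((Gamma a)^-1 `^ s * (4 * pi) `^ (- (n%:R / 2 * (s - 1)))) *
    (t `^ ((a - 1) * s - n%:R / 2 * (s - 1)) * \1_(`]0, d]%classic) t).

Lemma measurable_kernel_power_bound a s d :
  measurable_fun setT (kernel_power_bound a s d).
Proof.
by apply: measurable_funM => //; apply: measurable_funM => //.
Qed.

Lemma kernel_power_bound_ge0 a s d t : 0 <= kernel_power_bound a s d t.
Proof. by rewrite !mulr_ge0 ?powR_ge0. Qed.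

Local Open Scope ereal_scope.

(** Tonelli with space innermost, then a change of variable from the time [r] to the lag. *)
Lemma integral_spacetime_le (k : spacetime R n -> R) (h : R -> R) (b : bool) t :
  measurable_fun setT k -> (forall w, 0 <= k w)%R ->
  measurable_fun setT h -> (forall r, 0 <= h r)%R ->
  (forall r, \int[lebesgue_euclid R n]_y (k (y, r))%:E <=
     (h ((-1) ^+ b * r + t)%R)%:E) ->
  \int[lebesgue_spacetime R n]_w (k w)%:E <=
    \int[lebesgue_measure]_r (h r)%:E.
Proof.
move=> mk k0 mh h0 kh.
have mEk : measurable_fun setT (EFin \o k) by exact/measurable_EFinP.
have Ek0 w : 0 <= (EFin \o k) w by rewrite lee_fin.
have mEh : measurable_fun setT (EFin \o h) by exact/measurable_EFinP.
have Eh0 w : 0 <= (EFin \o h) w by rewrite lee_fin.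
rewrite /lebesgue_spacetime (fubini_tonelli2 _ mEk Ek0).
rewrite -(ge0_integral_affine_isometry _ b t _ mEh Eh0).
apply: ge0_le_integral => //.
- by move=> r _; apply: integral_ge0 => y _.
- exact: measurable_fun_fubini_tonelli_G.
- by apply: (measurableT_comp mEh); exact: measurable_funD.
- by move=> r _; exact: kh.
Qed.

Lemma integral_euclid_kernel_le a s d x t : (1 <= s)%R ->
  \int[lebesgue_euclid R n]_y ((if (t <= d)%R then
      frac_heat_kernel a (subE x y) t else 0%R) `^ s)%:E <=
  (kernel_power_bound a s d t)%:E.
Proof.
move=> s1.
(* Outside [0 < t <= d] the integrand is [0^s], which is 0 because [s] is nonzero. *)
have s0 : s != 0%R by lra.
have [td|td] := leP t d; last first.
  under eq_integral do rewrite powR0//.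
  by rewrite integral0 lee_fin kernel_power_bound_ge0.
have [t0|t0] := ltP 0%R t; last first.
  under eq_integral do rewrite /frac_heat_kernel ltNge t0 /= powR0//.
  by rewrite integral0 lee_fin kernel_power_bound_ge0.
rewrite /kernel_power_bound indicE mem_set ?mulr1; last first.
  by rewrite /= in_itv/= t0.
set C := (_ * _)%R.
have C0 : (0 <= C)%R by rewrite !mulr_ge0 ?powR_ge0.
set g := fun y =>
  (\prod_(i < n) normal_pdf (tnth x i) (Num.sqrt (2 * t)) (tnth y i))%R.
apply: (@le_trans _ _ (\int[lebesgue_euclid R n]_y (C%:E * (g y)%:E))).
  apply: ge0_le_integral => //.
  - by move=> y _; rewrite lee_fin powR_ge0.
  - apply/measurable_EFinP; apply: (measurableT_comp (measurable_powR _)).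
    rewrite (_ : (fun _ => _) = (fun y => t `^ (a - 1) / Gamma a * g y)%R).
      by apply: measurable_funM => //; exact: measurable_prod_normal_pdf.
    apply/funext => y.
    by rewrite /frac_heat_kernel t0 /g prod_normal_pdfE// mulrA.
  - apply: emeasurable_funM => //; apply/measurable_EFinP.
    exact: measurable_prod_normal_pdf.
  - by move=> y _; rewrite -EFinM lee_fin; exact: frac_heat_kernel_powR_le.
rewrite ge0_integralZl//=.
- by rewrite integral_prod_normal_pdf mule1.
- by apply/measurable_EFinP; exact: measurable_prod_normal_pdf.
- by move=> y _; rewrite lee_fin prodr_ge0// => i _; exact: normal_pdf_ge0.
Qed.

(** The integral of the bound over lags in []0, d]]. The exponent of [d] equals
    [(N - s (N - 2a)) / 2] with [N = n + 2], so it is positive exactly when [s (N - 2a) < N]. *)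
Definition kernel_mass a s d : R :=
  ((Gamma a)^-1 `^ s * (4 * pi) `^ (- (n%:R / 2 * (s - 1))) *
   (d `^ ((a - 1) * s - n%:R / 2 * (s - 1) + 1) /
     ((a - 1) * s - n%:R / 2 * (s - 1) + 1)))%R.

Lemma integral_kernel_power_bound a s d : (0 < d)%R ->
  (0 < (a - 1) * s - n%:R / 2 * (s - 1) + 1)%R ->
  \int[lebesgue_measure]_t (kernel_power_bound a s d t)%:E <=
  (kernel_mass a s d)%:E.
Proof.
move=> d0 e0; rewrite /kernel_power_bound /kernel_mass.
under eq_integral do rewrite EFinM.
rewrite ge0_integralZl//=; last 3 first.
- by apply/measurable_EFinP; apply: measurable_funM.
- by move=> t _; rewrite lee_fin mulr_ge0 ?powR_ge0.
- by rewrite lee_fin mulr_ge0 ?powR_ge0.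
rewrite [leRHS]EFinM; apply: lee_wpmul2l.
  by rewrite lee_fin mulr_ge0 ?powR_ge0.
have := integral_powR_le _ _ e0 d0; rewrite addrK; apply: le_trans.
rewrite [leRHS]integral_mkcond le_eqVlt; apply/orP; left; apply/eqP.
apply: eq_integral => t _; rewrite patchE indicE.
by case: ifP => _; rewrite ?mulr1 ?mulr0.
Qed.

Lemma short_time_kernel_mass a s d : (1 <= s)%R -> (0 < d)%R ->
  (0 < (a - 1) * s - n%:R / 2 * (s - 1) + 1)%R ->
  (forall z, \int[lebesgue_spacetime R n]_w
     (short_time_kernel R n a d (z, w) `^ s)%:E <= (kernel_mass a s d)%:E) /\
  (forall w, \int[lebesgue_spacetime R n]_z
     (short_time_kernel R n a d (z, w) `^ s)%:E <= (kernel_mass a s d)%:E).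
Proof.
move=> s1 d0 e0.
have mks : measurable_fun setT (fun zw => short_time_kernel R n a d zw `^ s)%R.
  apply: (measurableT_comp (measurable_powR s)).
  exact: measurable_short_time_kernel.
split=> z; apply: le_trans (integral_kernel_power_bound a s d d0 e0).
(* Rows: the lag [z.2 - r] is a reflection of [r]. *)
- apply: (integral_spacetime_le
    (fun w => short_time_kernel R n a d (z, w) `^ s)%R _ true z.2).
  + exact: (measurableT_comp mks (pair1_measurable z)).
  + by move=> w; exact: powR_ge0.
  + exact: measurable_kernel_power_bound.
  + exact: kernel_power_bound_ge0.
  + move=> r; rewrite /short_time_kernel/= mulN1r addrC.
    exact: integral_euclid_kernel_le.
(* Columns: the lag [r - z.2] is a translation, and the kernel is even in space. *)
- apply: (integral_spacetime_le
    (fun w => short_time_kernel R n a d (w, z) `^ s)%R _ false (- z.2)%R).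
  + exact: (measurableT_comp mks (pair2_measurable z)).
  + by move=> w; exact: powR_ge0.
  + exact: measurable_kernel_power_bound.
  + exact: kernel_power_bound_ge0.
  + move=> r; rewrite /short_time_kernel/= mul1r.
    under eq_integral do rewrite frac_heat_kernelC.
    exact: integral_euclid_kernel_le.
Qed.
Lemma kernel_mass_small a s (A : R) : (0 < A)%R ->
  (0 < (a - 1) * s - n%:R / 2 * (s - 1) + 1)%R ->
  exists2 d0, (0 < d0)%R &
    forall d, (0 < d <= d0)%R -> (kernel_mass a s d <= A)%R.
Proof.
rewrite /kernel_mass; set e := (_ + 1)%R; set C := (_ * (4 * pi) `^ _)%R.
move=> A0 e0.
have C0 : (0 <= C)%R by rewrite mulr_ge0 ?powR_ge0.
have C1 : (0 < C + 1)%R by rewrite ltr_wpDl.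
have X0 : (0 < A * e / (C + 1))%R by rewrite divr_gt0// mulr_gt0.
(* This solves [(C + 1) d^e / e = A]; adding 1 keeps the denominator positive, as only [0 <= C] is
   at hand. *)
exists ((A * e / (C + 1)) `^ e^-1)%R; first by rewrite powR_gt0.
move=> d /andP[d0 dX].
have de : (d `^ e <= A * e / (C + 1))%R.
  have -> : (A * e / (C + 1) = ((A * e / (C + 1)) `^ e^-1) `^ e)%R.
    by rewrite -powRrM mulVf ?gt_eqF// powRr1// ltW.
  by apply: ge0_ler_powR; rewrite ?nnegrE ?powR_ge0//; exact: ltW.
rewrite mulrA ler_pdivrMr//.
apply: (@le_trans _ _ (C * (A * e / (C + 1)))%R); first by rewrite ler_wpM2l.
rewrite mulrA ler_pdivrMr// mulrC ler_wpM2l ?lerDl//.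
by rewrite mulr_ge0// ltW.
Qed.
End short_time.

(** * Vanishing of the solutions *)

(* The library's hint for this instance does not see through
   [lebesgue_spacetime]. *)
#[local] Instance ae_spacetime_filter (R : realType) (n : nat) :
  Filter (almost_everywhere (lebesgue_spacetime R n)).
Proof. exact: (@ae_filter_ringOfSetsType _ _ _ (lebesgue_spacetime R n)). Qed.

(** The cut acts on the function and not on the domain of integration, so that Young's inequality
    applies on all of space-time. *)
Definition cut_before (R : realType) (n : nat) (c : R) (h : spacetime R n -> R)
  (w : spacetime R n) : R := if (w.2 : R) < c then h w else 0.

Section potential.
Context {R : realType} (n : nat).
Implicit Types (a b c d : R) (h : spacetime R n -> R).
Local Notation mu := (lebesgue_spacetime R n).

Lemma measurable_cut_before c h :
  measurable_fun setT h -> measurable_fun setT (cut_before R n c h).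
Proof.
move=> mh; apply: measurable_fun_ifT => //.
exact: measurable_fun_ltr.
Qed.

Lemma cut_before_ge0 c h :
  (forall w, 0 <= h w) -> forall w, 0 <= cut_before R n c h w.
Proof. by move=> h0 w; rewrite /cut_before; case: ifP. Qed.

Lemma measurable_before c : measurable (@before R n c).
Proof.
rewrite (_ : before c = snd @^-1` `]-oo, c[%classic); last first.
  by apply/seteqP; split => w; rewrite /before /= in_itv.
by rewrite -[X in measurable X]setTI; exact: measurable_snd.
Qed.

Local Open Scope ereal_scope.

Lemma measurable_heat_integrand a h z : measurable_fun setT h ->
  measurable_fun setT (fun w : spacetime R n =>
    (frac_heat_kernel a (subE z.1 w.1) ((z.2 : R) - w.2) * h w)%:E).
Proof.
move=> mh; apply/measurable_EFinP; apply: measurable_funM => //.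
exact: (measurableT_comp (measurable_frac_heat_kernel n a)
  (pair1_measurable z)).
Qed.

Lemma heat_potential_ge0 a h z : (forall w, 0 <= h w)%R ->
  0 <= heat_potential a h z.
Proof.
move=> h0; apply: integral_ge0 => w _.
by rewrite lee_fin mulr_ge0 ?frac_heat_kernel_ge0.
Qed.

(** Only sources at times between [b] and [z.2] matter. Their lag is below [c - b <= d] and their
    time below [c], so neither truncation loses anything. *)
Lemma heat_potential_le_short_time a h b c d z :
  measurable_fun setT h -> (forall w, 0 <= h w)%R ->
  {ae mu, forall w, (w.2 : R) < b -> h w = 0}%R ->
  (c <= b + d)%R -> ((z.2 : R) < c)%R ->
  heat_potential a h z <=
    \int[mu]_w (short_time_kernel R n a d (z, w) * cut_before R n c h w)%:E.
Proof.
move=> mh h0 hb cbd zc.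
rewrite /heat_potential integral_mkcond.
apply: ae_ge0_le_integral => //.
- move=> y _; apply: erestrict_ge0 => w _.
  by rewrite lee_fin mulr_ge0 ?frac_heat_kernel_ge0.
- apply/(measurable_restrictT _ (measurable_before _)).
  by apply: measurable_funTS; exact: measurable_heat_integrand.
- move=> w _.
  by rewrite lee_fin mulr_ge0 ?short_time_kernel_ge0 ?cut_before_ge0.
- apply/measurable_EFinP; apply: measurable_funM.
    exact: (measurableT_comp (measurable_short_time_kernel n a d)
      (pair1_measurable z)).
  exact: measurable_cut_before.
apply: filterS hb => w hb _; rewrite patchE.
case: ifPn => [/set_mem|_]; last first.
  by rewrite lee_fin mulr_ge0 ?short_time_kernel_ge0 ?cut_before_ge0.
rewrite /before /= => wz.
have [wb|bw] := ltP (w.2 : R) b.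
  by rewrite hb// mulr0 lee_fin mulr_ge0 ?short_time_kernel_ge0 ?cut_before_ge0.
rewrite /short_time_kernel/= ifT; last by lra.
by rewrite /cut_before ifT// (lt_trans wz).
Qed.

(** Causality: the potential at [z] sees only sources earlier than [z.2]. *)
Lemma heat_potential_eq0 a h b z :
  measurable_fun setT h -> (forall w, 0 <= h w)%R ->
  {ae mu, forall w, (w.2 : R) < b -> h w = 0}%R ->
  ((z.2 : R) <= b)%R -> heat_potential a h z = 0.
Proof.
move=> mh h0 hb zb; rewrite /heat_potential.
rewrite (ge0_ae_eq_integral (g := cst 0)) ?integral0//.
- exact: measurable_before.
- by apply: measurable_funTS; exact: measurable_heat_integrand.
- by move=> w _; rewrite lee_fin mulr_ge0 ?frac_heat_kernel_ge0.
apply: filterS hb => w hb wz; rewrite hb ?mulr0//.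
exact: lt_le_trans zb.
Qed.

End potential.

(** * Coupled smoothing estimates and marching in time *)

Section system.
Context {R : realType} (n : nat).
Implicit Types (a b c d p q s t A M : R) (f g h : spacetime R n -> R).
Local Notation mu := (lebesgue_spacetime R n).
Local Open Scope ereal_scope.

Lemma measurable_integral_short_time a d h :
  measurable_fun setT h -> (forall w, 0 <= h w)%R ->
  measurable_fun setT (fun z : spacetime R n =>
    \int[mu]_w (short_time_kernel R n a d (z, w) * h w)%:E).
Proof.
move=> mh h0.
apply: (measurable_fun_fubini_tonelli_F
  (EFin \o (fun zw => (short_time_kernel R n a d zw * h zw.2)%R))).
  apply/measurable_EFinP; apply: measurable_funM.
    exact: measurable_short_time_kernel.
  exact: (measurableT_comp mh measurable_snd).
by move=> zw; rewrite lee_fin mulr_ge0 ?short_time_kernel_ge0.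
Qed.

(** Before time [c] the potential is controlled by the truncated operator; after [c] the left
    integrand is [0^q = 0]. *)
Lemma integral_cut_powR_le a g h b c d t q :
  measurable_fun setT g -> (forall w, 0 <= g w)%R ->
  measurable_fun setT h -> (forall w, 0 <= h w)%R ->
  (0 < q)%R -> (0 < t)%R -> (c <= b + d)%R ->
  {ae mu, forall w, (w.2 : R) < b -> h w = 0}%R ->
  {ae mu, forall z, (g z)%:E <= heat_potential a h z `^ t} ->
  \int[mu]_z (cut_before R n c g z `^ q)%:E <=
  \int[mu]_z (\int[mu]_w (short_time_kernel R n a d (z, w) *
     cut_before R n c h w)%:E) `^ (t * q).
Proof.
move=> mg g0 mh h0 q0 t0 cbd hb gJ.
have cJ : measurable_fun setT (fun z : spacetime R n =>
    \int[mu]_w (short_time_kernel R n a d (z, w) * cut_before R n c h w)%:E).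
  apply: measurable_integral_short_time; first exact: measurable_cut_before.
  exact: cut_before_ge0.
have J0 z : 0 <= \int[mu]_w (short_time_kernel R n a d (z, w) *
    cut_before R n c h w)%:E.
  apply: integral_ge0 => w _.
  by rewrite lee_fin mulr_ge0 ?short_time_kernel_ge0 ?cut_before_ge0.
apply: ae_ge0_le_integral => //.
- by move=> z _; rewrite lee_fin powR_ge0.
- apply/measurable_EFinP; apply: (measurableT_comp (measurable_powR q)).
  exact: measurable_cut_before.
- by move=> z _; exact: poweR_ge0.
- exact: (measurableT_comp (measurable_poweR _) cJ).
apply: filterS gJ => z gJ _; rewrite /cut_before.
case: ifPn => [zc|_]; last by rewrite powR0 ?gt_eqF// poweR_ge0.
rewrite poweRrM -poweR_EFin; apply: gt0_ler_poweR; first exact: ltW.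
- by rewrite in_itv/= leey andbT lee_fin.
- by rewrite in_itv/= leey andbT poweR_ge0.
apply: (le_trans gJ); apply: gt0_ler_poweR; first exact: ltW.
- by rewrite in_itv/= leey andbT heat_potential_ge0.
- by rewrite in_itv/= leey andbT; exact: J0.
exact: (heat_potential_le_short_time _ _ _ b).
Qed.

(** Young's inequality from [L^p] to [L^(tq)] with kernel exponent [1/S]. The hypothesis on [a] says
    [(N - 2a)/S < N], that is, the kernel mass is finite and small with [d]. *)
Lemma integral_cut_powR_young a g h b c d t q p A M :
  measurable_fun setT g -> (forall w, 0 <= g w)%R ->
  measurable_fun setT h -> (forall w, 0 <= h w)%R ->
  (1 <= p)%R -> (0 < q)%R -> (0 < t)%R -> (p <= t * q)%R ->
  (n%:R + 2 - 2 * a < (n%:R + 2) * (1 + (t * q)^-1 - p^-1))%R ->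
  (0 < d)%R -> (c <= b + d)%R ->
  (0 < A)%R -> (0 < M)%R ->
  (kernel_mass n a (1 + (t * q)^-1 - p^-1)^-1 d <= A)%R ->
  {ae mu, forall w, (w.2 : R) < b -> h w = 0}%R ->
  {ae mu, forall z, (g z)%:E <= heat_potential a h z `^ t} ->
  \int[mu]_z (cut_before R n c h z `^ p)%:E <= M%:E ->
  \int[mu]_z (cut_before R n c g z `^ q)%:E <=
  (A `^ (t * q * (1 + (t * q)^-1 - p^-1)) * M `^ (t * q / p))%:E.
Proof.
move=> mg g0 mh h0 p1 q0 t0 ptq.
set S := (1 + _ - _)%R => e d0 cbd A0 M0 massA hb gJ hM.
have p0 : (0 < p)%R by lra.
have r0 : (0 < t * q)%R by exact: mulr_gt0.
have p1' : (p^-1 <= 1)%R by rewrite invf_le1.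
have S0 : (0 < S)%R.
  by have : (0 < (t * q)^-1)%R by [rewrite invr_gt0]; rewrite /S; lra.
have S1 : (S <= 1)%R.
  by have : ((t * q)^-1 <= p^-1)%R by [rewrite lef_pV2]; rewrite /S; lra.
have s1 : (1 <= S^-1)%R by rewrite invf_ge1.
have e0 : (0 < (a - 1) * S^-1 - n%:R / 2 * (S^-1 - 1) + 1)%R.
  have -> : ((a - 1) * S^-1 - n%:R / 2 * (S^-1 - 1) + 1 =
    S^-1 / 2 * ((n%:R + 2) * S - (n%:R + 2 - 2 * a)))%R.
    by field; rewrite gt_eqF.
  by rewrite mulr_gt0 ?divr_gt0 ?subr_gt0// invr_gt0.
have [m1 m2] := short_time_kernel_mass n a S^-1 d s1 d0 e0.
apply: (le_trans (integral_cut_powR_le _ _ _ _ _ _ _ _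
  mg g0 mh h0 q0 t0 cbd hb gJ)).
(* Puts the exponent of [A] in the form [r / s] with [s = 1/S]. *)
rewrite -{1}(invrK S).
apply: (@young_integral_operator _ _ _ mu (short_time_kernel R n a d)
  (cut_before R n c h) p (t * q) S^-1) => //.
- exact: measurable_short_time_kernel.
- exact: measurable_cut_before.
- exact: short_time_kernel_ge0.
- exact: cut_before_ge0.
- by rewrite invr_gt0.
- rewrite -[(t * q)%R]invrK lef_pV2 ?posrE ?invr_gt0//.
  by rewrite /S; lra.
- by rewrite invrK /S; lra.
- by move=> z; apply: (le_trans (m1 z)); rewrite lee_fin.
- by move=> w; apply: (le_trans (m2 w)); rewrite lee_fin.
Qed.

Lemma kernel_mass_small_lebesgue a p q t A :
  (1 <= p)%R -> (0 < q)%R -> (0 < t)%R -> (p <= t * q)%R ->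
  (n%:R + 2 - 2 * a < (n%:R + 2) * (1 + (t * q)^-1 - p^-1))%R ->
  (0 < A)%R ->
  exists2 d0, (0 < d0)%R & forall d, (0 < d <= d0)%R ->
    (kernel_mass n a (1 + (t * q)^-1 - p^-1)^-1 d <= A)%R.
Proof.
move=> p1 q0 t0 ptq; set S : R := (1 + _ - _)%R => e A0.
have p0 : (0 < p)%R by lra.
have S0 : (0 < S)%R.
  have : (0 < (t * q)^-1)%R by rewrite invr_gt0 mulr_gt0.
  have : (p^-1 <= 1)%R by rewrite invf_le1.
  by rewrite /S; lra.
apply: kernel_mass_small => //.
have -> : ((a - 1) * S^-1 - n%:R / 2 * (S^-1 - 1) + 1 =
  S^-1 / 2 * ((n%:R + 2) * S - (n%:R + 2 - 2 * a)))%R.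
  by field; rewrite gt_eqF.
by rewrite mulr_gt0 ?divr_gt0 ?subr_gt0// invr_gt0.
Qed.

Lemma heat_potential_dominated_eq0 a g h b t :
  (forall w, 0 <= g w)%R -> measurable_fun setT h -> (forall w, 0 <= h w)%R ->
  (0 < t)%R ->
  {ae mu, forall w, (w.2 : R) < b -> h w = 0}%R ->
  {ae mu, forall z, (g z)%:E <= heat_potential a h z `^ t} ->
  {ae mu, forall w, (w.2 : R) < b -> g w = 0}%R.
Proof.
move=> g0 mh h0 t0 hb; apply: filterS => z gz zb.
move: gz; rewrite (heat_potential_eq0 n a h b z mh h0 hb (ltW zb)).
rewrite poweR0r ?gt_eqF// lee_fin => gz.
by apply/eqP; rewrite eq_le gz g0.
Qed.

Lemma cut_integral_eq0 c h p : measurable_fun setT h ->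
  (forall w, 0 <= h w)%R -> (0 < p)%R ->
  \int[mu]_z (cut_before R n c h z `^ p)%:E = 0 ->
  {ae mu, forall w, (w.2 : R) < c -> h w = 0}%R.
Proof.
move=> mh h0 p0 I0.
have mc : measurable_fun setT (EFin \o (fun z => cut_before R n c h z `^ p)%R).
  apply/measurable_EFinP; apply: (measurableT_comp (measurable_powR p)).
  exact: measurable_cut_before.
have : \int[mu]_z `|(EFin \o (fun z => cut_before R n c h z `^ p)%R) z| = 0.
  rewrite -[RHS]I0; apply: eq_integral => z _ /=.
  by rewrite ger0_norm ?powR_ge0.
move/(ae_eq_integral_abs mu measurableT mc); apply: filterS => z /= /(_ I).
move=> [hz] zc; have := powR_eq0_eq0 hz.
by rewrite /cut_before zc.
Qed.

(** The energy is the [L^p] integral of [f]; [g] is measured in [L^q] in between. The conditions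
    [p <= t q] and [q <= t' p] allow the two Young steps, and [t' t >= 1] makes a short step a
    contraction. *)
Lemma system_eq0_before f g p q t t' a a' :
  measurable_fun setT f -> (forall w, 0 <= f w)%R ->
  measurable_fun setT g -> (forall w, 0 <= g w)%R ->
  (1 <= p)%R -> (1 <= q)%R -> (0 < t)%R -> (0 < t')%R -> (1 <= t' * t)%R ->
  (p <= t * q)%R -> (q <= t' * p)%R ->
  (n%:R + 2 - 2 * a < (n%:R + 2) * (1 + (t * q)^-1 - p^-1))%R ->
  (n%:R + 2 - 2 * a' < (n%:R + 2) * (1 + (t' * p)^-1 - q^-1))%R ->
  {ae mu, forall z, (g z)%:E <= heat_potential a f z `^ t} ->
  {ae mu, forall z, (f z)%:E <= heat_potential a' g z `^ t'} ->
  {ae mu, forall w, (w.2 : R) < 0 -> f w = 0}%R ->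
  (forall T, \int[mu]_z (cut_before R n T f z `^ p)%:E < +oo) ->
  forall T, {ae mu, forall w, (w.2 : R) < T -> f w = 0}%R.
Proof.
move=> mf f0 mg g0 p1 q1 t0 t'0 tt ptq qtp.
set S : R := (1 + _ - _)%R; set S' : R := (1 + _ - _)%R => e e' gJ fJ fneg fp T.
have p0 : (0 < p)%R by lra.
have q0 : (0 < q)%R by lra.
pose I c := \int[mu]_z (cut_before R n c f z `^ p)%:E.
have I0 c : 0 <= I c by apply: integral_ge0 => z _; rewrite lee_fin powR_ge0.
have Ifin c : I c = (fine (I c))%:E by rewrite fineK// ge0_fin_numE// fp.
have mI c :
    measurable_fun setT (EFin \o (fun z => cut_before R n c f z `^ p)%R).
  apply/measurable_EFinP; apply: (measurableT_comp (measurable_powR p)).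
  exact: measurable_cut_before.
have Ile c : (c <= T)%R -> I c <= I T.
  move=> cT; apply: ge0_le_integral => //.
  - by move=> z _; rewrite lee_fin powR_ge0.
  - exact: mI.
  - exact: mI.
  move=> z _; rewrite lee_fin; apply: ge0_ler_powR; first exact: ltW.
  - by rewrite nnegrE cut_before_ge0.
  - by rewrite nnegrE cut_before_ge0.
  rewrite /cut_before; case: ifPn => [zc|_].
    by rewrite (lt_le_trans zc cT).
  by case: ifP.
(* A bound for every [I c] with [c <= T], made positive by the added 1. *)
pose M0 := (fine (I T) + 1)%R.
have M00 : (0 < M0)%R by rewrite ltr_wpDl// fine_ge0.
(* The product of the two smoothing estimates bounds [I c] by
   [A^kappa (I c)^(t' t)], where [A] is small with the length of the step. *)
pose kappa := (t' * p * S' + t * q * S * (t' * p / q))%R.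
have S0 : (0 < S)%R.
  have : (0 < (t * q)^-1)%R by rewrite invr_gt0 mulr_gt0.
  have : (p^-1 <= 1)%R by rewrite invf_le1.
  by rewrite /S; lra.
have S'0 : (0 < S')%R.
  have : (0 < (t' * p)^-1)%R by rewrite invr_gt0 mulr_gt0.
  have : (q^-1 <= 1)%R by rewrite invf_le1.
  by rewrite /S'; lra.
have kappa0 : (0 < kappa)%R by rewrite addr_gt0 ?mulr_gt0 ?invr_gt0.
(* As [t' t >= 1], this dominates [m^(t' t - 1)] for all [m <= M0]; [A] is then tuned so that the
   contraction factor is one half. *)
pose N := (M0 `^ (t' * t - 1))%R.
have N0 : (0 < N)%R by rewrite powR_gt0.
have [A A0 AN] : exists2 A, (0 < A)%R & (A `^ kappa * N = 2^-1)%R.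
  exists ((2 * N)^-1 `^ kappa^-1)%R.
    by rewrite powR_gt0// invr_gt0 mulr_gt0.
  rewrite -powRrM mulVf ?gt_eqF// powRr1; last first.
    by rewrite invr_ge0 mulr_ge0 ?ltW.
  by field; rewrite gt_eqF.
have [d1 d10 d1A] := kernel_mass_small_lebesgue a p q t A p1 q0 t0 ptq e A0.
have [d2 d20 d2A] := kernel_mass_small_lebesgue a' q p t' A q1 p0 t'0 qtp e' A0.
pose d := Num.min d1 d2.
have d0 : (0 < d)%R by rewrite lt_min d10.
have dA : (kernel_mass n a S^-1 d <= A)%R by apply: d1A; rewrite d0 ge_min lexx.
have dA' : (kernel_mass n a' S'^-1 d <= A)%R.
  by apply: d2A; rewrite d0 ge_min lexx orbT.
have step b c : (c <= b + d)%R -> (c <= T)%R ->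
    {ae mu, forall w, (w.2 : R) < b -> f w = 0}%R ->
    {ae mu, forall w, (w.2 : R) < c -> f w = 0}%R.
  move=> cbd cT fb.
  have gb := heat_potential_dominated_eq0 a g f b t g0 mf f0 t0 fb gJ.
  apply: (cut_integral_eq0 _ _ p) => //; rewrite -/(I c) Ifin.
  set m := fine (I c).
  have m0 : (0 <= m)%R by exact: fine_ge0.
  (* If [m = 0] the slab is done; otherwise [m] is a legitimate positive bound for Young's
     inequality. *)
  have [->//|mn0] := eqVneq m 0%R.
  have mp : (0 < m)%R by rewrite lt_neqAle eq_sym mn0.
  have mM0 : (m <= M0)%R.
    rewrite /M0 -lee_fin EFinD -!Ifin (le_trans (Ile c cT))//.
    by rewrite leeDl.
  pose M := (A `^ (t * q * S) * m `^ (t * q / p))%R.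
  have M_gt0 : (0 < M)%R by apply: mulr_gt0; exact: powR_gt0.
  have gM : \int[mu]_z (cut_before R n c g z `^ q)%:E <= M%:E.
    apply: (integral_cut_powR_young a g f b c d t q p A m) => //.
    by rewrite -/(I c) Ifin.
  have : I c <= (A `^ (t' * p * S') * M `^ (t' * p / q))%:E.
    exact: (integral_cut_powR_young a' f g b c d t' p q A M).
  rewrite Ifin -/m lee_fin.
  (* The powers of [m] combine to [t' t], from which one factor [m] is split off. *)
  have -> : (A `^ (t' * p * S') * M `^ (t' * p / q) =
      m * (A `^ kappa * m `^ (t' * t - 1)))%R.
    rewrite /M powRM ?powR_ge0// -!powRrM mulrA -powRD ?(gt_eqF A0) ?implybT//.
    rewrite -/kappa.
    have -> : (t * q / p * (t' * p / q) = t' * t)%R.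
      by field; rewrite ?gt_eqF.
    have t't0 : (0 < t' * t)%R by exact: mulr_gt0.
    by rewrite -(mulr_powRB1 m0 t't0) mulrCA.
  have half : (A `^ kappa * m `^ (t' * t - 1) <= 2^-1)%R.
    rewrite -AN ler_wpM2l ?powR_ge0//.
    by apply: ge0_ler_powR; rewrite ?nnegrE ?subr_ge0// ltW.
  move=> /le_trans/(_ (ler_wpM2l m0 half)) mm.
  (* Now [m <= m / 2], against [0 < m]. *)
  by exfalso; clear -mp mm; lra.
(* March in slabs of the fixed length [d], capped at [T] because [d] was chosen from the energy up
   to [T]. *)
have steps k : {ae mu, forall w, (w.2 : R) < Num.min (d * k%:R) T -> f w = 0}%R.
  elim: k => [|k IHk].
    apply: filterS fneg => w fw wT; apply: fw; apply: (lt_le_trans wT).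
    by rewrite mulr0 ge_min lexx.
  apply: (step _ _ _ _ IHk).
    have [dT|dT] := leP (d * k%:R)%R T.
      by rewrite ge_min -natr1 mulrDr mulr1 lexx.
    by rewrite ge_min lerDl (ltW d0) orbT.
  by rewrite ge_min lexx orbT.
have := steps (Num.truncn (T / d)).+1.
rewrite min_r//.
by rewrite -ler_pdivrMl// mulrC ltW// truncnS_gt.
Qed.

End system.

(* [rho] is the reciprocal of the Lebesgue exponent of the intermediate
   function; the bounds say that both smoothing steps are subcritical. *)
Lemma intermediate_exponent (R : realFieldType) (N p lam sig a b : R) :
  0 < N -> 1 <= p -> 0 < lam -> 0 < sig -> 0 < a -> 0 < b ->
  1 <= p * lam -> 1 <= lam * sig ->
  (N - 2 * p * a) * sig < N * p ->
  (N - 2 * p * a) * sig * lam < 2 * p * b * lam + N ->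
  exists rho, [/\ 0 < rho, 1 <= p * lam * sig * rho, p * rho <= 1,
    sig * rho <= 1 & (N - 2 * p * a < N * p * rho) /\
    (N * sig * rho * (p * lam) < 2 * b * (p * lam) + N)].
Proof.
move=> N0 p1 lam0 sig0 a0 b0 pl ls h1 h2.
have p0 : 0 < p by lra.
(* [L1] and [L2] are the two lower bounds imposed on [rho]. [L1] may be attained, [L2] may not, so
   [rho = L1] is taken when [L2 < L1]. *)
set L1 := (p * lam * sig)^-1.
have pls0 : 0 < p * lam * sig by rewrite !mulr_gt0.
have L10 : 0 < L1 by rewrite invr_gt0.
have L1E : p * lam * sig * L1 = 1 by rewrite mulfV// gt_eqF.
have pL1 : p * L1 <= 1.
  by rewrite ler_pdivrMr// mul1r -mulrA ler_peMr// ltW.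
have sL1 : sig * L1 <= 1.
  by rewrite ler_pdivrMr// mul1r ler_peMl// ltW.
pose L2 := (N - 2 * p * a) / (N * p).
have Np0 : 0 < N * p by exact: mulr_gt0.
have [L21|L12] := ltP L2 L1.
  exists L1; split => //; first by rewrite L1E.
  split.
    by move: L21; rewrite /L2 ltr_pdivrMr// (mulrC L1).
  have -> : N * sig * L1 * (p * lam) = N * (p * lam * sig * L1) by ring.
  by rewrite L1E mulr1 ltrDr !mulr_gt0.
(* Otherwise [rho] is the midpoint between [L2] and the least upper bound imposed, [m]. That
   [L2 < m] comes from [0 < a], [h1] and [h2] for the three terms of the minimum. *)
pose U := (2 * b * (p * lam) + N) / (N * sig * (p * lam)).
have Ns0 : 0 < N * sig * (p * lam) by rewrite !mulr_gt0.
pose m := Num.min p^-1 (Num.min sig^-1 U).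
have L2m : L2 < m.
  rewrite !lt_min; apply/and3P; split.
  - rewrite /L2 ltr_pdivrMr// mulrCA mulVf ?gt_eqF// mulr1.
    by rewrite ltrBlDr ltrDl !mulr_gt0.
  - by rewrite /L2 ltr_pdivrMr// ltr_pdivlMl// (mulrC sig).
  - rewrite /U /L2 ltr_pdivrMr// [ltRHS]mulrAC ltr_pdivlMr//.
    have -> : (N - 2 * p * a) * (N * sig * (p * lam)) =
      (N * p) * ((N - 2 * p * a) * sig * lam) by ring.
    rewrite [ltRHS]mulrC ltr_pM2l//; apply: (lt_le_trans h2).
    by rewrite le_eqVlt; apply/orP; left; apply/eqP; ring.
have [mp ms mU] : [/\ m <= p^-1, m <= sig^-1 & m <= U].
  by rewrite /m; split; rewrite !ge_min lexx ?orbT.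
exists ((L2 + m) / 2).
have L2rho : L2 < (L2 + m) / 2 by lra.
have rhom : (L2 + m) / 2 < m by lra.
set rho := (L2 + m) / 2 in L2rho rhom *.
have L1rho : L1 <= rho by lra.
split.
- exact: lt_le_trans L1rho.
- by rewrite -L1E ler_pM2l.
- by rewrite mulrC -ler_pdivlMr// div1r; lra.
- by rewrite mulrC -ler_pdivlMr// div1r; lra.
split.
- by rewrite [ltRHS]mulrC -ltr_pdivrMr.
- have := lt_le_trans rhom mU; rewrite /U ltr_pdivlMr// => H.
  by rewrite (_ : _ * rho * _ = rho * (N * sig * (p * lam)))//; ring.
Qed.

(** * From the differential inequalities to the integral system *)

Section inequalities.
Context {R : realType} (n : nat).
Implicit Types (p q a b c t : R) (f g h u v : spacetime R n -> R).
Local Notation mu := (lebesgue_spacetime R n).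

Lemma frac_heatP p a u : Yspace p a u ->
  Xspace p (frac_heat p a u) /\ heat_potential_of a (frac_heat p a u) u.
Proof.
move=> [f Xf uf]; rewrite /frac_heat.
case: (xgetP (cst 0) [set f | Xspace p f /\ heat_potential_of a f u]).
  by move=> f' _.
by move=> /(_ f)[].
Qed.

Lemma eq_heat_potential a f g z :
  measurable_fun setT f -> measurable_fun setT g ->
  {ae mu, forall w, f w = g w} ->
  heat_potential a f z = heat_potential a g z.
Proof.
move=> mf mg fg; apply: ae_eq_integral.
- exact: measurable_before.
- by apply: measurable_funTS; exact: measurable_heat_integrand.
- by apply: measurable_funTS; exact: measurable_heat_integrand.
by apply: filterS fg => w -> _.
Qed.

Lemma measurable_posr f : measurable_fun setT f ->
  measurable_fun setT (fun w => Num.max (f w) 0).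
Proof. by move=> mf; exact: measurable_maxr. Qed.

(** The [p]-th power of the finite norm is the integral of [|f|^p] before [c], and the positive part
    is at most [|f|]. *)
Lemma Xspace_integral_lty p f c : 0 < p -> Xspace p f ->
  (\int[mu]_z (cut_before R n c (fun w => Num.max (f w) 0) z `^ p)%:E < +oo)%E.
Proof.
move=> p0 [mf /(_ c) fc].
have mm := measurable_posr f mf.
have := @poweR_lty _ _ p fc.
rewrite poweR_Lnorm ?gt_eqF//; apply: le_lt_trans.
apply: ge0_le_integral => //.
- by move=> z _; rewrite lee_fin powR_ge0.
- apply/measurable_EFinP; apply: (measurableT_comp (measurable_powR p)).
  exact: measurable_cut_before.
- apply: (measurableT_comp (measurable_poweR _)); apply: measurableT_comp => //.
  apply/(measurable_restrictT _ (measurable_before n c)).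
  by apply: measurable_funTS; exact/measurable_EFinP.
move=> z _; rewrite /cut_before patchE.
have -> : (z \in before c) = (z.2 < c)%R.
  by apply/idP/idP => [/set_mem//|zc]; exact/mem_set.
case: ifP => _ /=; last by rewrite normr0.
rewrite lee_fin; apply: ge0_ler_powR; rewrite ?nnegrE ?le_max ?lexx ?orbT//.
  exact: ltW.
by rewrite ge_max ler_norm normr_ge0.
Qed.

(** Deliberately asymmetric: the energy is that of the first right-hand side in [L^p], so the lemma
    can be applied to the two inequalities in either order. *)
Lemma heat_inequalities_eq0 p q a b lam sig u v :
  1 <= p -> 0 < a -> 0 < b -> 0 < lam -> 0 < sig ->
  1 <= p * lam -> 1 <= lam * sig ->
  (n%:R + 2 - 2 * p * a) * sig < (n%:R + 2) * p ->
  (n%:R + 2 - 2 * p * a) * sig * lam < 2 * p * b * lam + (n%:R + 2) ->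
  Yspace p a u -> Yspace q b v ->
  (\forall z \ae mu,
     0 <= frac_heat p a u z /\ frac_heat p a u z <= v z `^ lam) ->
  (\forall z \ae mu,
     0 <= frac_heat q b v z /\ frac_heat q b v z <= u z `^ sig) ->
  (\forall z \ae mu, (z.2 : R) < 0 -> u z = 0 /\ v z = 0) ->
  \forall z \ae mu, u z = 0 /\ v z = 0.
Proof.
move=> p1 a0 b0 lam0 sig0 pl ls h1 h2 /frac_heatP[Xf uf] /frac_heatP[Xg vg].
set f0 := frac_heat p a u in Xf uf *; set g0 := frac_heat q b v in Xg vg *.
move=> f0v g0u uv0.
have N0 : 0 < n%:R + 2 :> R by rewrite ltr_wpDl.
have [rho [rho0 plsr pr sr [r1 r2]]] :=
  intermediate_exponent _ _ _ _ _ _ _ N0 p1 lam0 sig0 a0 b0 pl ls h1 h2.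
(* The right-hand sides are nonnegative only almost everywhere; positive parts are representatives
   nonnegative everywhere. *)
pose f w := Num.max (f0 w) 0; pose g w := Num.max (g0 w) 0.
have mf0 : measurable_fun setT f0 by case: Xf.
have mg0 : measurable_fun setT g0 by case: Xg.
have mf : measurable_fun setT f := measurable_posr f0 mf0.
have mg : measurable_fun setT g := measurable_posr g0 mg0.
have f_ge0 w : 0 <= f w by rewrite le_max lexx orbT.
have g_ge0 w : 0 <= g w by rewrite le_max lexx orbT.
have ff0 : {ae mu, forall w, f0 w = f w}.
  by apply: filterS f0v => w [fw _]; rewrite /f max_l.
have gg0 : {ae mu, forall w, g0 w = g w}.
  by apply: filterS g0u => w [gw _]; rewrite /g max_l.
have uJ : {ae mu, forall z, (u z)%:E = heat_potential a f z}.
  by apply: filterS uf => z ->; exact: eq_heat_potential.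
have vJ : {ae mu, forall z, (v z)%:E = heat_potential b g z}.
  by apply: filterS vg => z ->; exact: eq_heat_potential.
have p0 : 0 < p by lra.
have ps0 : 0 < p * lam by exact: mulr_gt0.
(* The chain of exponents: [f] in [L^p], [u] in [L^(1/rho)], [g <= u^sig] in [L^s], [v] in
   [L^(p lam)], and back to [f <= v^lam] in [L^p]. *)
pose s := (sig * rho)^-1.
have s0 : 0 < s by rewrite invr_gt0 mulr_gt0.
have sE : sig * s = rho^-1 by rewrite /s invfM mulrA mulfV ?mul1r// gt_eqF.
have fT : forall T : R, {ae mu, forall w, (w.2 : R) < T -> f w = 0}.
  apply: (system_eq0_before n f g p s sig lam a b) => //.
  - by rewrite invf_ge1 ?mulr_gt0.
  - rewrite sE -[p]invrK lef_pV2 ?posrE ?invr_gt0//.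
    by rewrite -[p^-1]mul1r ler_pdivlMr// mulrC.
  - rewrite /s -[leRHS]invrK lef_pV2 ?posrE ?invr_gt0 ?mulr_gt0//.
    rewrite -[leLHS]mul1r ler_pdivrMr ?mulr_gt0//; apply: (le_trans plsr).
    by rewrite le_eqVlt; apply/orP; left; apply/eqP; ring.
  - rewrite sE invrK -(ltr_pM2r p0).
    have -> : (n%:R + 2) * (1 + rho - p^-1) * p =
      (n%:R + 2) * p + (n%:R + 2) * p * rho - (n%:R + 2) * (p^-1 * p) by ring.
    by rewrite mulVf ?gt_eqF// mulr1; lra.
  - rewrite /s invrK -(ltr_pM2r ps0) (mulrC lam).
    have -> : (n%:R + 2) * (1 + (p * lam)^-1 - sig * rho) * (p * lam) =
      (n%:R + 2) * (p * lam) + (n%:R + 2) * ((p * lam)^-1 * (p * lam)) -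
      (n%:R + 2) * sig * rho * (p * lam) by ring.
    by rewrite mulVf ?gt_eqF// mulr1; lra.
  - apply: filterS3 uJ g0u gg0 => z uz [_ gz] <-.
    by rewrite -uz poweR_EFin lee_fin.
  - apply: filterS3 vJ f0v ff0 => z vz [_ fz] <-.
    by rewrite -vz poweR_EFin lee_fin.
  - apply: filterS3 uv0 f0v ff0 => z uvz [f0z fz] <- z0.
    have [_ vz] := uvz z0; apply/eqP; rewrite eq_le f0z andbT.
    by move: fz; rewrite vz powR0// gt_eqF.
  - by move=> T; exact: Xspace_integral_lty.
(* From [f = 0] one gets in turn [u = 0], then [g <= u^sig = 0], then [v = 0]. *)
have u0 : {ae mu, forall z, u z = 0}.
  apply: filterS uJ => z uz; apply: EFin_inj; rewrite uz.
  exact: (heat_potential_eq0 n a f z.2).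
have g_eq0 : {ae mu, forall w, g w = 0}.
  apply: filterS3 u0 g0u gg0 => z uz [g0z gz] <-.
  apply/eqP; rewrite eq_le g0z andbT.
  by move: gz; rewrite uz powR0// gt_eqF.
apply: filterS2 u0 vJ => z uz vz; split => //.
have gz : {ae mu, forall w, (w.2 : R) < z.2 -> g w = 0}.
  by apply: filterS g_eq0 => w gw _.
apply: EFin_inj; rewrite vz.
exact: (heat_potential_eq0 n b g z.2 z mg g_ge0 gz (lexx _)).
Qed.

End inequalities.

Theorem theorem2p1 (R : realType) (n : nat) (p q lam sig alpha beta : R)
    (u v : spacetime R n -> R) :
  (1 <= n)%N -> 1 <= p -> 1 <= q ->
  0 < lam -> 0 < sig -> 0 < alpha -> 0 < beta ->
  admissible n p alpha -> admissible n q beta ->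
  (n%:R + 2 - 2 * p * alpha) * q ^+ 2 * sig <=
    (n%:R + 2 - 2 * q * beta) * p ^+ 2 * lam ->
  2 * p * alpha < n%:R + 2 ->
  1 / lam <= sig ->
  sig < 2 * p * beta / (n%:R + 2 - 2 * p * alpha) +
        (n%:R + 2) / ((n%:R + 2 - 2 * p * alpha) * lam) ->
  Yspace p alpha u -> Yspace q beta v ->
  (\forall z \ae lebesgue_spacetime R n,
     0 <= frac_heat p alpha u z /\ frac_heat p alpha u z <= v z `^ lam) ->
  (\forall z \ae lebesgue_spacetime R n,
     0 <= frac_heat q beta v z /\ frac_heat q beta v z <= u z `^ sig) ->
  (\forall z \ae lebesgue_spacetime R n,
     (z.2 : R) < 0 -> u z = 0 /\ v z = 0) ->
  \forall z \ae lebesgue_spacetime R n, u z = 0 /\ v z = 0.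
Proof.
move=> _ p1 q1 lam0 sig0 a0 b0 _ _ cross pa lamsig sigmu Yu Yv fv gu uv0.
set N : R := n%:R + 2 in cross pa sigmu.
set D := N - 2 * p * alpha in cross sigmu.
set D' := N - 2 * q * beta in cross.
have N0 : 0 < N by rewrite ltr_wpDl.
have D0 : 0 < D by rewrite subr_gt0.
have p0 : 0 < p by lra.
have q0 : 0 < q by lra.
have ls : 1 <= lam * sig by move: lamsig; rewrite ler_pdivrMr// mulrC.
(* The bound [sig < mu(lam)] with denominators cleared. *)
have DN : D * sig * lam < 2 * p * beta * lam + N.
  have -> : 2 * p * beta * lam + N =
      D * lam * (2 * p * beta / D + N / (D * lam)).
    by field; rewrite !gt_eqF.
  by rewrite mulrAC ltr_pM2l// mulr_gt0.
have D'N : D' < N by rewrite /D' ltrBlDr ltrDl !mulr_gt0.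
have [pl|pl] := leP 1 (p * lam).
  apply: (heat_inequalities_eq0 n p q alpha beta lam sig) => //.
  rewrite -/N -/D.
  have [//|DNp] := ltP (D * sig) (N * p).
  (* If [N p <= D sig], the cross condition and [1 <= q] give [N q <= D' p lam = N p lam - 2 q beta
     p lam]. With [N p lam <= D sig lam] and [DN] this yields [N q < N], which is absurd. *)
  exfalso.
  have h1 : N * q <= D' * p * lam.
    have : N * p * q ^+ 2 <= D' * p ^+ 2 * lam.
      by apply: le_trans cross; rewrite [leRHS]mulrAC ler_wpM2r// sqr_ge0.
    have -> : D' * p ^+ 2 * lam = p * (D' * p * lam) by ring.
    have -> : N * p * q ^+ 2 = p * (N * q ^+ 2) by ring.
    rewrite ler_pM2l//; apply: le_trans.
    by rewrite ler_pM2l// expr2 ler_peMl// ltW.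
  have h2 : N * q <= N * p * lam - 2 * q * beta * p * lam.
    apply: (le_trans h1).
    by rewrite /D' le_eqVlt; apply/orP; left; apply/eqP; ring.
  have h3 : N * p * lam <= D * sig * lam by rewrite ler_pM2r.
  have h4 : 2 * p * beta * lam <= 2 * q * beta * p * lam.
    have -> : 2 * q * beta * p * lam = q * (2 * p * beta * lam) by ring.
    by rewrite ler_peMl// !mulr_ge0// ltW.
  have h5 : N <= N * q by rewrite ler_peMr// ltW.
  lra.
(* From here on [p lam < 1]; then [1 <= p < sig], so [q sig >= 1] and the exchanged system is in
   range. *)
have sp : p < sig.
  by rewrite -(ltr_pM2r lam0) (lt_le_trans pl)// mulrC.
have lamlt1 : lam < 1.
  by apply: le_lt_trans pl; rewrite ler_peMl// ltW.
have vu0 : \forall z \ae lebesgue_spacetime R n,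
    (z.2 : R) < 0 -> v z = 0 /\ u z = 0.
  by apply: filterS uv0 => z uvz /uvz[].
have X : D' * p * lam < N * q.
  have [D'0|D'0] := ltP 0 D'.
    rewrite -mulrA (@lt_le_trans _ _ D') ?gtr_pMr//.
    by rewrite (le_trans (ltW D'N))// ler_peMr// ltW.
  apply: (@le_lt_trans _ _ 0); last exact: mulr_gt0.
  by rewrite -mulrA mulr_le0_ge0// mulr_ge0// ltW.
suff : \forall z \ae lebesgue_spacetime R n, v z = 0 /\ u z = 0.
  by apply: filterS => z [].
apply: (heat_inequalities_eq0 n q p beta alpha sig lam) => //.
- by rewrite (le_trans p1)// (le_trans (ltW sp))// ler_peMl// ltW.
- by rewrite mulrC.
- rewrite -/N -/D'; have [D'0|D'0] := ltP 0 D'.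
    rewrite (@lt_le_trans _ _ D') ?gtr_pMr//.
    by rewrite (le_trans (ltW D'N))// ler_peMr// ltW.
  apply: (@le_lt_trans _ _ 0); last exact: mulr_gt0.
  by rewrite mulr_le0_ge0// ltW.
rewrite -/N -/D'.
(* After multiplication by [p q], the cross condition replaces [D q^2 sig] by [D' p^2 lam]. Both
   sides then carry the factor [q sig + p], and the claim reduces to [X]. *)
have pq0 : 0 < p * q by exact: mulr_gt0.
rewrite -(ltr_pM2l pq0).
have -> : p * q * (D' * lam * sig) = q * sig * (D' * p * lam) by ring.
have -> : p * q * (2 * q * alpha * sig + N) =
  N * q * (q * sig + p) - D * q ^+ 2 * sig by rewrite /D; ring.
rewrite ltrBrDr (le_lt_trans (lerD (lexx _) cross))//.
have -> : q * sig * (D' * p * lam) + D' * p ^+ 2 * lam =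
  D' * p * lam * (q * sig + p) by ring.
by rewrite ltr_pM2r// addr_gt0// mulr_gt0.
Qed.
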